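(* Let $S_P \subset \mathbb{R}^2$ be a parabola. For each tree $G$ there exist another suitably chosen parabola $S'_P \subset \mathbb{R}^2$ and an RA-region $(D,\{S_{\lambda}\}_{\lambda \in \Lambda})$ of $\mathbb{R}^2$, with $\Lambda$ finite, such that each $S_{\lambda}$ is a parabola congruent to either $S_P$ or $S'_P$, and such that the Poincaré-Reeb graph ${\rm PR}_{(D,\{S_{\lambda}\}_{\lambda \in \Lambda})}$ is defined and is isomorphic to $G$.
   Context: **Graphs.** A graph is a $1$-dimensional connected CW complex such that the closure of each $1$-cell (edge) is homeomorphic to the closed interval $D^1$; its vertices are its $0$-cells. A tree is a finite graph with no cycle (equivalently, with first Betti number $0$); vertices of degree $2$ are allowed. **Parabolas.** Two subsets of $\mathbb{R}^2$ are congruent if one is carried to the other by a composition of finitely many rotations, translations and reflections. A parabola is a set congruent to $\{(x_1,x_2)\in\mathbb{R}^2 \mid x_2=a(x_1-p_1)^2+p_2\}$ for some $(p_1,p_2)\in\mathbb{R}^2$ and $a\neq 0$. **Real algebraic manifolds.** A real algebraic manifold is a union $Z_c$ of some connected components of the zero set $c^{-1}(0)$ of a real polynomial map $c:\mathbb{R}^{k_1}\to\mathbb{R}^{k_2}$ such that $c$ has no singular point (point where the differential is not of full rank) on $Z_c$. **RA-regions.** Let $D\subset\mathbb{R}^n$ be a non-empty connected open set with closure $\overline{D}$ in $\mathbb{R}^n$. Let $\{S_\lambda\}_{\lambda\in\Lambda}$ be a family of $(n-1)$-dimensional real algebraic manifolds in $\mathbb{R}^n$, where each $S_\lambda$ is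 a union of some components of the zero set of a real polynomial $f_\lambda$ (which is the polynomial giving $S_\lambda$ its structure of real algebraic manifold), and $S_\lambda\cap\overline{D}\neq\emptyset$ for each $\lambda$. The pair $(D,\{S_\lambda\}_{\lambda\in\Lambda})$ is an RA-region of $\mathbb{R}^n$ if: 1. there is a connected open neighborhood $U_D$ of $\overline{D}$ such that $D=U_D\cap\bigcap_{\lambda\in\Lambda}\{x\mid f_\lambda(x)>0\}$ and $U_D\cap S_\lambda=U_D\cap\{x\mid f_\lambda(x)=0\}$ for each $\lambda$; 2. each point of $\overline{D}$ lies in at most $n$ distinct manifolds of the family, and if $p\in\overline{D}$ lies in exactly the $n_p$ distinct manifolds $S_{\lambda_1},\dots,S_{\lambda_{n_p}}$ with $1\le n_p\le n$, then $\dim\bigcap_{j=1}^{n_p}T_pS_{\lambda_j}=n-n_p$. **Singular points of an RA-region.** Let $\pi_{n,1}:\mathbb{R}^n\to\mathbb{R}$ be the projection to the first coordinate. A point $p\in\overline{D}$ is a singular point of the RA-region if either (i) $p$ lies in exactly $n_p<n$ distinct manifolds $S_{\lambda_1},\dots,S_{\lambda_{n_p}}$ and $p$ is a critical point of the restriction of $\pi_{n,1}$ to the $(n-n_p)$-dimensional manifold consisting of all points of $\overline{D}$ contained in these $n_p$ manifolds and in no other $S_\lambda$; or (ii) $p$ lies in exactly $n$ distinct manifolds of the family. **Reeb space.** For a continuous map $c:X\to Y$, declare $p_1\sim_c p_2$ if $p_1$ and $p_2$ lie in the same connected component of the same preimage $c^{-1}(q)$. The Reeb space is $R_c:=X/{\sim_c}$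 with the quotient topology, and $q_c:X\to R_c$ is the quotient map. **Poincaré-Reeb graph.** Suppose $\Lambda$ is finite and the quotient map $q_{\pi_{n,1}|_{\overline{D}}}:\overline{D}\to R_{\pi_{n,1}|_{\overline{D}}}$ is proper (preimages of compact sets are compact). The Poincaré-Reeb graph ${\rm PR}_{(D,\{S_\lambda\}_{\lambda\in\Lambda})}$ is the Reeb space $R_{\pi_{n,1}|_{\overline{D}}}$ with the graph structure in which a point $v$ is a vertex if and only if its preimage under $q_{\pi_{n,1}|_{\overline{D}}}$ contains a singular point of the RA-region. *)

(* Defs.v *)
From HB Require Import structures.
(* Imported first and without its notations: some of its names and notations
   clash with those of the other libraries. *)
From mathcomp Require Import -(notations) mpoly.
From mathcomp Require Import all_boot all_order all_algebra.
From mathcomp Require Import all_classical all_reals all_analysis.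

Set Implicit Arguments.
Unset Strict Implicit.
Unset Printing Implicit Defensive.

Import Order.TTheory GRing.Theory Num.Theory.
Import numFieldNormedType.Exports.

Local Open Scope classical_set_scope.
Local Open Scope ring_scope.
Local Open Scope quotient_scope.

(** * Graphs *)

(* X is a 1-dimensional connected CW complex with 0-skeleton V and with the
   1-cells phi e `]0, 1[, where phi e, restricted to [0, 1], is the
   characteristic map of the cell e.  Closures of 1-cells are required to be
   homeomorphic to [0, 1]: in the Hausdorff space X this says that phi e is
   injective on the whole of [0, 1], so there are no loops, but multiple edges
   are allowed.  The complex is genuinely 1-dimensional, i.e. it has a 1-cell. *)
Record is_graph (R : realType) (X : topologicalType) (V : set X)
    (E : Type) (phi : E -> R -> X) : Prop := IsGraph {
  graph_hausdorff : hausdorff_space X;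
  graph_connected : connected [set: X];
  graph_has_edge : inhabited E;
  graph_continuous : forall e, {within `[0, 1], continuous (phi e)};
  graph_injective : forall e, {in `[0, 1] &, injective (phi e)};
  graph_ends : forall e, V (phi e 0) /\ V (phi e 1);
  graph_cells_disjoint : forall e e' (s t : R), 0 < s < 1 -> 0 < t < 1 ->
    phi e s = phi e' t -> e = e';
  graph_cells_vertices : forall e (t : R), 0 < t < 1 -> ~ V (phi e t);
  graph_cover : forall x, V x \/ exists e (t : R), 0 < t < 1 /\ phi e t = x;
  graph_weak_topology : forall A : set X,
    (forall e, closed (`[0, 1] `&` phi e @^-1` A)) -> closed A
}.

(* A cycle: k + 2 distinct vertices, cyclically joined by distinct edges. *)
Definition has_cycle (R : realType) (X : topologicalType) (V : set X)
    (E : Type) (phi : E -> R -> X) : Prop :=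
  exists (k : nat) (v : 'I_k.+2 -> X) (e : 'I_k.+2 -> E),
    [/\ injective v, injective e, forall i, V (v i) &
        forall i, [set phi (e i) 0; phi (e i) 1] = [set v i; v (ordS i)]].

Definition is_tree (R : realType) (X : topologicalType) (V : set X)
    (E : finType) (phi : E -> R -> X) : Prop :=
  [/\ is_graph V phi, finite_set V & ~ has_cycle V phi].

(* An isomorphism of graphs is a homeomorphism mapping the vertex set onto the
   vertex set; the open edges are the components of the complement of the
   vertex set, so they need not be mentioned. *)
Definition graph_isomorphic (X Y : topologicalType) (V : set X) (W : set Y) :
    Prop :=
  exists (h : X -> Y) (g : Y -> X),
    [/\ continuous h, continuous g, cancel h g, cancel g h & h @` V = W].

(** * Parabolas *)

Section Parabolas.
Variable R : realType.
Implicit Types (A B P : set 'rV[R]_2).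

Definition vec2 (a b : R) : 'rV[R]_2 := \row_j (if j == 0 then a else b).

Definition rotation (c : 'rV[R]_2) (t : R) (x : 'rV[R]_2) : 'rV[R]_2 :=
  let y := x - c in
  c + vec2 (cos t * y 0 0 - sin t * y 0 1) (sin t * y 0 0 + cos t * y 0 1).

Definition translation (v x : 'rV[R]_2) : 'rV[R]_2 := x + v.

(* The reflection in the line through c with direction (cos t, sin t). *)
Definition reflection (c : 'rV[R]_2) (t : R) (x : 'rV[R]_2) : 'rV[R]_2 :=
  let y := x - c in
  c + vec2 (cos (2 * t) * y 0 0 + sin (2 * t) * y 0 1)
           (sin (2 * t) * y 0 0 - cos (2 * t) * y 0 1).

Inductive congruence : ('rV[R]_2 -> 'rV[R]_2) -> Prop :=
| congruence_id : congruence id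
| congruence_rotation c t g : congruence g -> congruence (rotation c t \o g)
| congruence_translation v g : congruence g -> congruence (translation v \o g)
| congruence_reflection c t g : congruence g -> congruence (reflection c t \o g).

Definition congruent A B : Prop := exists2 g, congruence g & g @` A = B.

Definition is_parabola P : Prop :=
  exists (a : R) (p : 'rV[R]_2), a != 0 /\
    congruent P [set x | x 0 1 = a * (x 0 0 - p 0 0) ^+ 2 + p 0 1].

End Parabolas.

(** * RA-regions of R^(n+1) *)

Section RARegions.
Variables (R : realType) (n : nat).
Local Notation pt := 'rV[R]_n.+1.
Implicit Types (p x v : pt) (f : mpoly n.+1 R) (D U M Z : set pt).

Definition peval f x : R := meval (fun i => x 0 i) f.

Definition zero_set f : set pt := [set x | peval f x = 0].

Definition gradient f x : pt := \row_i peval (mderiv i f) x.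

(* Z is a union of connected components of the zero set of f, and the
   differential of f has full rank, i.e. rank 1, at each point of Z. *)
Definition real_algebraic_hypersurface Z f : Prop :=
  (exists2 C, C `<=` zero_set f &
     Z = \bigcup_(x in C) connected_component (zero_set f) x) /\
  (forall x, Z x -> gradient f x != 0).

(* The tangent space at p of a submanifold M: velocities at p of curves in M. *)
Definition tangent_space M p : set pt :=
  [set v | exists2 c : R -> pt,
     c 0 = p /\ (\forall t \near (0 : R), M (c t)) &
     is_derive (0 : R) (1 : R) c v].

Definition has_dim (T : set pt) (d : nat) : Prop :=
  exists W : {vspace pt}, [/\ \dim W = d & forall v, v \in W <-> T v].

Section Region.
Variables (D : set pt) (L : Type) (S : L -> set pt).

(* As a set of sets, this disregards repetitions in the family S. *)
Definition manifolds_through p : set (set pt) := [set S l | l in [set l | S l p]].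

Record is_RA_region (f : L -> mpoly n.+1 R) : Prop := IsRARegion {
  RA_nonempty : D !=set0;
  RA_connected : connected D;
  RA_open : open D;
  RA_hypersurface : forall l, real_algebraic_hypersurface (S l) (f l);
  RA_meets_closure : forall l, S l `&` closure D !=set0;
  RA_neighborhood : exists U,
    [/\ open U, connected U, closure D `<=` U,
        D = U `&` \bigcap_l [set x | 0 < peval (f l) x] &
        forall l, U `&` S l = U `&` zero_set (f l)];
  RA_multiplicity : forall p, closure D p -> (manifolds_through p #<= `I_n.+1)%card;
  RA_transversality : forall p k, closure D p -> (1 <= k <= n.+1)%N ->
    (manifolds_through p #= `I_k)%card ->
    has_dim (\bigcap_(l in [set l | S l p]) tangent_space (S l) p) (n.+1 - k)
}.

(* The points of the closure of D lying in the same S l as p. *)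
Definition stratum p : set pt :=
  [set x | closure D x /\ forall l, S l x <-> S l p].

Definition proj1_critical M p : Prop :=
  forall v, tangent_space M p v -> v 0 0 = 0.

Definition singular_point p : Prop :=
  closure D p /\
  ((exists2 k, (k < n.+1)%N &
      (manifolds_through p #= `I_k)%card /\ proj1_critical (stratum p) p) \/
   (manifolds_through p #= `I_n.+1)%card).

End Region.
End RARegions.

(** * Reeb spaces *)

Section ReebSpace.
Variables (X Y : topologicalType) (c : X -> Y).

Definition reeb_rel (x y : X) : bool :=
  `[< exists q : Y, connected_component (c @^-1` [set q]) x y >].

Lemma reeb_rel_refl : reflexive reeb_rel.
Proof. by move=> x; apply/asboolP; exists (c x); exact: connected_component_refl. Qed.

Lemma reeb_rel_sym : symmetric reeb_rel.
Proof.
by move=> x y; apply/asboolP/asboolP => -[q xy]; exists q;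
  exact: connected_component_sym.
Qed.

Lemma reeb_rel_trans : transitive reeb_rel.
Proof.
move=> y x z /asboolP[q xy] /asboolP[r yz]; apply/asboolP; exists q.
have qE : c y = q := connected_component_sub xy.
have rE : c y = r.
  apply: (@connected_component_sub _ (c @^-1` [set r]) z).
  exact: connected_component_sym.
apply: connected_component_trans xy _.
by rewrite -qE rE.
Qed.

Canonical reeb_equiv :=
  EquivRel reeb_rel reeb_rel_refl reeb_rel_sym reeb_rel_trans.

Definition reeb_space : topologicalType :=
  quotient_topology {eq_quot reeb_equiv}.

Definition reeb_quot (x : X) : reeb_space :=
  \pi_(quotient_topology {eq_quot reeb_equiv}) x.

End ReebSpace.

Definition proper_map (X Y : topologicalType) (h : X -> Y) : Prop :=
  forall K : set Y, compact K -> compact (h @^-1` K).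

(** * The Poincaré-Reeb graph *)

Section PoincareReeb.
Variables (R : realType) (n : nat) (D : set 'rV[R]_n.+1).

(* The projection to the first coordinate, on the subspace closure D. *)
Definition proj1_closure (x : closure D) : R := (set_val x : 'rV[R]_n.+1) 0 0.

Definition PR_space : topologicalType := reeb_space proj1_closure.

Definition PR_quot : closure D -> PR_space := reeb_quot proj1_closure.

Definition PR_vertices (L : Type) (S : L -> set 'rV[R]_n.+1) : set PR_space :=
  [set v | exists2 p : closure D, singular_point D S (set_val p) & PR_quot p = v].

Definition PR_defined (L : Type) : Prop :=
  finite_set [set: L] /\ proper_map PR_quot.

End PoincareReeb.

Arguments PR_vertices {R n} D {L} S.

(* Main.v *)
(* Every region used here is bounded by translates of one parabola
   [x = a * y ^ 2], congruent to the given one, and by one narrower parabola.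
   Number the vertices of the tree in depth-first preorder, starting from a
   leaf, and give the root a very low height and the [i]-th vertex the height
   [i].  The upper boundary is the graph [x = m y] of a minimum of [n] translates
   of [a * y ^ 2], with one corner per vertex, at the height of that vertex;
   between two consecutive corners [m] descends exactly to the height of the
   parent of the next vertex.  The lower boundary is an increasing arc of the
   narrower parabola, joining the two extreme corners.  The shear
   [(x, y) |-> (x - a * y ^ 2, y)] makes the region convex.
   Along the arcs of [m], the map sending [(x, y)] to the point of height [x] on
   the path from the root to the vertex whose corner dominates [y] identifies
   two points exactly when their common level set does not separate them, i.e.
   its fibres are the Reeb classes.  A continuous bijection from a compact space
   to a Hausdorff space being a homeomorphism, the Reeb space is the tree. *)

Require Import Defs.
From mathcomp Require Import -(notations) mpoly.
From mathcomp Require Import all_boot all_order all_algebra.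
From mathcomp Require Import all_classical all_reals all_analysis.
From mathcomp Require Import ring lra zify.

Import Order.TTheory GRing.Theory Num.Theory.
Import numFieldNormedType.Exports.

Set Implicit Arguments.
Unset Strict Implicit.
Unset Printing Implicit Defensive.

Local Open Scope classical_set_scope.
Local Open Scope ring_scope.

(** * Reeb spaces of compact spaces *)

(** Every arc has the coefficient [a], so only its vertex is free: for [i > 1] the arc [i] must
    descend from the corner [i - 1] to the height of the parent of [i] and climb to the corner [i],
    which fixes its horizontal extent through square roots. The bottom must be one parabola that
    stays below all arcs and meets their minimum at the two extreme corners only. Both follow from
    [a < a']: the gap between an arc and the bottom is then a strictly concave quadratic,
    nonnegative over the extreme corners. But [a'] is forced to be the total height divided by the
    squared width, so the root has to be low enough. This is why the root is a leaf: only the first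
    arc reaches it, and the width does not depend on its depth. As the bottom increases, two points
    of height [x] lie in one component of a level set exactly when no descent of [m] between them
    goes below [x]. The descents reach the heights of the parents [pa l], and in preorder the least
    [pa l] with [i < l <= j] is the last common ancestor of [i] and [j]; so this is also the
    condition for the paths to [i] and [j] to agree at height [x]. *)

Lemma compact_set_type (T : topologicalType) (A : set T) :
  compact A -> compact [set: A].
Proof.
move=> cA F PF _.
have GA : (set_val @ F) A.
  by apply: (@filterS _ F _ setT) => [x _ /=|]; [exact: set_valP|exact: filterT].
have [p [Ap Fp]] := cA _ _ GA.
exists (exist _ p (mem_set Ap)); split => //.
move=> B U FB [_ [[W oW <-] /= Wp] WU].
have GB : (set_val @ F) (set_val @` B) by exact: (filterS (@preimage_image _ _ set_val B) FB).
have [|_ [[q Bq <-] Wq]] := Fp _ W GB; first exact: open_nbhs_nbhs.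
by exists q; split => //; exact: WU.
Qed.

Section ReebFactor.
Variables (T X Y : topologicalType) (c : T -> Y) (F : T -> X).
Hypotheses (Tcompact : compact [set: T]) (Xhausdorff : hausdorff_space X)
  (Fcont : continuous F) (Fsurj : forall x, exists p, F p = x)
  (Ffib : forall p q, F p = F q <-> reeb_rel c p q).

Let g (v : reeb_space c) : X := F (repr v).

Lemma reeb_quot_eq p q : (reeb_quot c p = reeb_quot c q) <-> reeb_rel c p q.
Proof.
split=> [|pq]; first by move/eqquotP.
by apply/eqquotP.
Qed.

Lemma reeb_factorE p : g (reeb_quot c p) = F p.
Proof.
apply/Ffib/reeb_quot_eq.
by rewrite /reeb_quot reprK.
Qed.

Lemma reeb_quot_surj v : exists p, reeb_quot c p = v.
Proof. by exists (repr v); rewrite /reeb_quot reprK. Qed.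

Lemma reeb_factor_homeo : exists (h : X -> reeb_space c) (k : reeb_space c -> X),
  [/\ continuous h, continuous k, cancel h k, cancel k h &
      forall p, k (reeb_quot c p) = F p].
Proof.
have [s sE] := choice Fsurj.
have gK : cancel g (reeb_quot c \o s).
  move=> v; have [p <-] := reeb_quot_surj v.
  by rewrite reeb_factorE /=; apply/reeb_quot_eq/Ffib; rewrite sE.
exists (reeb_quot c \o s), g; split => //; last 2 first.
- by move=> x /=; rewrite reeb_factorE sE.
- exact: reeb_factorE.
- apply/continuous_closedP => A cA.
  have -> : (reeb_quot c \o s) @^-1` A = F @` (reeb_quot c @^-1` A).
    apply/seteqP; split=> [x /= Ax|_ [p /= Ap <-]]; first by exists (s x).
    suff -> : reeb_quot c (s (F p)) = reeb_quot c p by [].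
    by apply/reeb_quot_eq/Ffib; rewrite sE.
  apply: compact_closed => //; apply: continuous_compact.
    exact/continuous_subspaceT.
  apply: (subclosed_compact _ Tcompact) => //.
  by move: A cA; apply/continuous_closedP; exact: pi_continuous.
- apply/quotient_continuous.
  by rewrite (_ : _ \o _ = F) //; apply/funext => p; exact: reeb_factorE.
Qed.

(** Under the homeomorphism with the Hausdorff space [X], compact sets of the Reeb space are closed;
    closed sets have compact preimages because [T] is compact. *)
Lemma reeb_quot_proper : proper_map (reeb_quot c).
Proof.
have [h [k [hc kc hK kK kE]]] := reeb_factor_homeo.
move=> K cK.
have -> : reeb_quot c @^-1` K = F @^-1` (k @` K).
  apply/seteqP; split=> [p /= Kp|p [v Kv /= e]]; first by exists (reeb_quot c p).
  by move: Kv; rewrite -(kK v) e -kE kK.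
apply: (subclosed_compact _ Tcompact) => //.
have : closed (k @` K).
  apply: compact_closed => //; apply: continuous_compact => //.
  exact/continuous_subspaceT.
by move: (k @` K); apply/continuous_closedP.
Qed.

End ReebFactor.

(** * Depth-first search in a tree *)

Definition ancestor (pa : nat -> nat) (i j : nat) := exists k, iter k pa i = j.

Section Ancestors.
Variables (pa : nat -> nat) (n : nat).
Hypotheses (pa0 : pa 0%N = 0%N) (pa_lt : forall i, (0 < i <= n)%N -> (pa i < i)%N).

Lemma iter_parent_le k i : (i <= n)%N -> (iter k pa i <= i)%N.
Proof.
move=> le_in; elim: k => //= k IHk.
case: (posnP (iter k pa i)) => [->|gt0]; first by rewrite pa0.
apply: (leq_trans _ IHk); apply/ltnW/pa_lt.
by rewrite gt0 (leq_trans IHk le_in).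
Qed.

Lemma ancestor_le i j : (i <= n)%N -> ancestor pa i j -> (j <= i)%N.
Proof. by move=> ? [k <-]; exact: iter_parent_le. Qed.

Lemma ancestor_refl i : ancestor pa i i.
Proof. by exists 0%N. Qed.

Lemma ancestor_trans j i l : ancestor pa i j -> ancestor pa j l -> ancestor pa i l.
Proof. by move=> [k <-] [k' <-]; exists (k' + k)%N; rewrite iterD. Qed.

Lemma ancestor_parent i : ancestor pa i (pa i).
Proof. by exists 1%N. Qed.

Lemma ancestorS i j : ancestor pa i j -> j = i \/ ancestor pa (pa i) j.
Proof. by move=> [[|k] <-]; [left|right; exists k; rewrite -iterSr]. Qed.

Lemma ancestor_chain i j l : (i <= n)%N -> ancestor pa i j -> ancestor pa i l ->
  (l <= j)%N -> ancestor pa j l.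
Proof.
move=> le_in [a <-] [b <-].
case: (leqP a b) => [/subnK <- _|/ltnW/subnK <- le_ba].
  by exists (b - a)%N; rewrite -iterD.
exists 0%N => /=; apply/eqP; rewrite eqn_leq le_ba andbT iterD.
by rewrite iter_parent_le // (leq_trans (iter_parent_le b le_in)).
Qed.

(** With the least number of steps the root, where [pa] stays put, can only be reached at the end,
    so the indices strictly decrease. Such a path closes up to a cycle in [unvisited_cycle]. *)
Lemma ancestor_strict_path i j : (i <= n)%N -> ancestor pa i j -> j != i ->
  exists k, iter k.+1 pa i = j /\
    forall s t, (s < t <= k.+1)%N -> (iter t pa i < iter s pa i)%N.
Proof.
move=> le_in anc_ij ne_ij.
have ex : exists k, iter k pa i == j by case: anc_ij => k /eqP; exists k.
case: (ex_minnP ex) => -[|k] /eqP e kmin; first by rewrite -e eqxx in ne_ij.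
exists k; split => // s t /andP[lt_st le_tk].
have step r : (r <= k)%N -> (iter r.+1 pa i < iter r pa i)%N.
  move=> le_rk /=; apply: pa_lt.
  rewrite (leq_trans (iter_parent_le r le_in) le_in) andbT lt0n.
  apply/eqP => r0; have : (k.+1 <= r)%N.
    apply: kmin; rewrite r0 -e -(subnK (leqW le_rk)) iterD r0.
    by apply/eqP; elim: (k.+1 - r)%N => //= ? <-.
  by rewrite ltnNge le_rk.
elim: t lt_st le_tk => // t IHt; rewrite ltnS => le_st lt_tk.
apply: (leq_trans (step _ lt_tk)).
by move: le_st; rewrite leq_eqVlt => /predU1P[->//|/IHt]/(_ (ltnW lt_tk))/ltnW.
Qed.

End Ancestors.

Section DepthFirst.
Variables (R : realType) (X : topologicalType) (V : set X) (E : finType)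
  (phi : E -> R -> X).
Hypothesis hG : is_tree V phi.

Let G : is_graph V phi. Proof. by case: hG. Qed.

Definition joins (e : E) (u v : X) :=
  (phi e 0 = u /\ phi e 1 = v) \/ (phi e 0 = v /\ phi e 1 = u).

Lemma joinsC e u v : joins e u v -> joins e v u.
Proof. by case; [right|left]. Qed.

Lemma joins_neq e u : ~ joins e u u.
Proof.
have inj01 : phi e 0 <> phi e 1.
  move/(graph_injective G) => /=; rewrite !in_itv /= !lexx !ler01 => /(_ isT isT).
  by move/esym/eqP; rewrite oner_eq0.
by case=> -[a b]; apply: inj01; rewrite a b.
Qed.

Lemma joins_vertex e u v : joins e u v -> V u /\ V v.
Proof. by case: (graph_ends G e) => ? ? [[<- <-]|[<- <-]]. Qed.

Lemma joins_ends e u v a b : joins e u v -> joins e a b ->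
  (a = u /\ b = v) \/ (a = v /\ b = u).
Proof.
by move=> [[<- <-]|[<- <-]] [[<- <-]|[<- <-]]; [left|right|right|left].
Qed.

(* The vertices are numbered by [q] in preorder; the vertex [q i] is reached
   from its parent [q (pa i)] through the edge [e i]. *)
Record preorder (n : nat) (q : nat -> X) (e : nat -> E) (pa : nat -> nat) :
    Prop := Preorder {
  pre_root : V (q 0%N) /\ pa 0%N = 0%N;
  pre_pa : forall i, (0 < i <= n)%N -> (pa i < i)%N;
  pre_joins : forall i, (0 < i <= n)%N -> joins (e i) (q (pa i)) (q i);
  pre_inj : forall i j, (i <= n)%N -> (j <= n)%N -> q i = q j -> i = j;
  pre_anc : forall i, (i < n)%N -> ancestor pa i (pa i.+1)
}.

Definition visited (n : nat) (e : nat -> E) f :=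
  exists2 i, (0 < i <= n)%N & e i = f.

(* The invariant of the search: only the current branch is still open. *)
Definition exhausted (n : nat) q e pa :=
  forall j f v, (j <= n)%N -> joins f (q j) v -> ~ visited n e f -> ancestor pa n j.

Section Step.
Variables (n : nat) (q : nat -> X) (e : nat -> E) (pa : nat -> nat).
Hypothesis P : preorder n q e pa.

Let pa0 : pa 0%N = 0%N. Proof. by case: (pre_root P). Qed.

(** The edge [e i] joins [q i] to an earlier vertex, so its later end determines [i]. *)
Lemma preorder_edge_inj i j : (0 < i <= n)%N -> (0 < j <= n)%N -> e i = e j -> i = j.
Proof.
wlog lt_ij : i j / (i <= j)%N => [H|] ilt jlt eij.
  by case: (leqP i j) => [/H|/ltnW/H h]; [exact|apply/esym/h].
move: lt_ij; rewrite leq_eqVlt => /predU1P[//|lt_ij].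
have := joins_ends (pre_joins P ilt); rewrite eij => /(_ _ _ (pre_joins P jlt)).
have [ip jp] := (pre_pa P ilt, pre_pa P jlt).
by case=> -[_] /(pre_inj P); lia.
Qed.

Lemma preorder_card : (n <= #|E|)%N.
Proof.
rewrite -(card_ord n); apply: (@leq_card _ _ (fun i : 'I_n => e i.+1)).
move=> i j /preorder_edge_inj eij.
by apply/val_inj/eqP; rewrite -eqSS; apply/eqP/eij; rewrite /= ltn_ord.
Qed.

(** The path from [q j] up to [q l], closed by [f], would be a cycle; parallel edges are covered,
    since [has_cycle] allows two vertices. *)
Lemma unvisited_cycle j l f : (j <= n)%N -> ancestor pa j l -> joins f (q j) (q l) ->
  ~ visited n e f -> False.
Proof.
move=> le_jn anc_jl fjl nf.
have ne_lj : l != j by apply/eqP => el; apply: (@joins_neq f (q j)); rewrite -{2}el.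
have [k [kl dec]] := ancestor_strict_path pa0 (pre_pa P) le_jn anc_jl ne_lj.
case: hG => _ _; apply.
have le_it s : (iter s pa j <= n)%N.
  exact: leq_trans (iter_parent_le pa0 (pre_pa P) _ le_jn) le_jn.
have pos s : (s <= k)%N -> (0 < iter s pa j <= n)%N.
  by move=> sk; rewrite le_it andbT (leq_trans _ (dec s k.+1 _)) // ltnS sk leqnn.
have itinj s t : (s <= k.+1)%N -> (t <= k.+1)%N -> iter s pa j = iter t pa j -> s = t.
  wlog lt_st : s t / (s <= t)%N => [H|] sk tk est.
    by case: (leqP s t) => [/H|/ltnW/H h]; [exact|apply/esym/h].
  move: lt_st; rewrite leq_eqVlt => /predU1P[//|lt_st].
  by have := dec s t; rewrite lt_st tk est ltnn => /(_ isT).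
exists k, (fun i => q (iter i pa j)),
  (fun i => if (i <= k)%N then e (iter i pa j) else f); split.
- move=> s t /(pre_inj P (le_it _) (le_it _))/itinj st.
  by apply/val_inj/st; rewrite -ltnS.
- move=> s t; case: (leqP s k) => sk; case: (leqP t k) => tk.
  + move/(preorder_edge_inj (pos _ sk) (pos _ tk))/itinj => st.
    by apply/val_inj/st; exact: leqW.
  + by move=> ef; case: nf; exists (iter s pa j) => //; exact: pos.
  + by move=> ef; case: nf; exists (iter t pa j) => //; exact: pos.
  + by move=> _; apply/val_inj => /=; have := ltn_ord s; have := ltn_ord t; lia.
- move=> i; have [->|i0] := posnP (iter i pa j); first by case: (pre_root P).
  have ii : (0 < iter i pa j <= n)%N by rewrite i0 le_it.
  by have [] := joins_vertex (pre_joins P ii).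
- have joinsE g u v : joins g u v -> [set phi g 0; phi g 1] = [set v; u].
    by move=> [[-> ->]|[-> ->]] //; rewrite setUC.
  move=> i /=; case: (leqP i k) => ik.
    rewrite modn_small ?ltnS //.
    by rewrite (joinsE _ _ _ (pre_joins P (pos _ ik))).
  have -> : (i : nat) = k.+1 by have := ltn_ord i; lia.
  by rewrite modnn kl /= (joinsE _ _ _ fjl).
Qed.

(** The search resumes at the largest index [j] that still has an unvisited edge. If the far end of
    that edge were already numbered, both ends would lie on the current branch, which closes a
    cycle. All indices beyond [j] are finished, so only the branch through [j] stays open. *)
Lemma preorder_step j f v : exhausted n q e pa -> (j <= n)%N ->
  joins f (q j) v -> ~ visited n e f ->
  exists q' e' pa', [/\ preorder n.+1 q' e' pa', exhausted n.+1 q' e' pa' &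
    q' 0%N = q 0%N].
Proof.
move=> ex le_jn fj nf.
pose Q i := `[< (i <= n)%N /\ exists f v, joins f (q i) v /\ ~ visited n e f >].
have exQ : exists i, Q i by exists j; apply/asboolP; split => //; exists f, v.
have Qb i : Q i -> (i <= n)%N by move/asboolP => [].
case: (ex_maxnP exQ Qb) => {fj nf exQ le_jn f v}j /asboolP[le_jn [f [v [fj nf]]]] jmax.
have anc_j := ex _ _ _ le_jn fj nf.
have vnew i : (i <= n)%N -> q i <> v.
  move=> le_in qi; rewrite -qi in fj.
  have anc_i := ex _ _ _ le_in (joinsC fj) nf.
  case: (leqP i j) => [le_ij|/ltnW le_ji].
    apply: (unvisited_cycle le_jn _ fj nf).
    exact: (ancestor_chain pa0 (pre_pa P) _ anc_j anc_i).
  apply: (unvisited_cycle le_in _ (joinsC fj) nf).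
  exact: (ancestor_chain pa0 (pre_pa P) _ anc_i anc_j).
pose upd T (s : nat -> T) x i := if i == n.+1 then x else s i.
have updE T (s : nat -> T) x i : (i <= n)%N -> upd T s x i = s i.
  by rewrite /upd; case: eqP => // ->; rewrite ltnn.
have updn T (s : nat -> T) x : upd T s x n.+1 = x by rewrite /upd eqxx.
have anc_upd i l : (i <= n)%N -> ancestor pa i l -> ancestor (upd _ pa j) i l.
  move=> le_in [k <-]; exists k; elim: k => //= k ->; rewrite updE //.
  exact: leq_trans (iter_parent_le pa0 (pre_pa P) _ le_in) le_in.
have anc_jn i : (i <= n)%N -> (i <= j)%N -> ancestor pa n i ->
    ancestor (upd _ pa j) n.+1 i.
  move=> le_in le_ij anc_i.
  apply: (@ancestor_trans _ j); last first.
    apply: anc_upd => //.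
    exact: (ancestor_chain pa0 (pre_pa P) _ anc_j anc_i).
  by exists 1%N; rewrite /= updn.
exists (upd _ q v), (upd _ e f), (upd _ pa j); split; last by rewrite updE.
- split.
  + by rewrite !updE //; exact: (pre_root P).
  + move=> i /andP[i0]; rewrite leq_eqVlt => /predU1P[->|]; first by rewrite updn.
    by rewrite ltnS => le_in; rewrite updE //; apply: (pre_pa P); rewrite i0.
  + move=> i /andP[i0]; rewrite leq_eqVlt => /predU1P[->|].
      by rewrite !updn updE.
    rewrite ltnS => le_in.
    have ii : (0 < i <= n)%N by rewrite i0.
    rewrite !updE //; first exact: (pre_joins P).
    exact: leq_trans (ltnW (pre_pa P ii)) le_in.
  + move=> i l; rewrite leq_eqVlt => /predU1P[->|];
      last rewrite ltnS => le_in; rewrite leq_eqVlt => /predU1P[->|];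
      try rewrite ltnS => le_ln; rewrite ?updn ?updE //.
    * by move/esym/vnew; case.
    * by move/vnew; case.
    * exact: (pre_inj P).
  + move=> i; rewrite ltnS leq_eqVlt => /predU1P[->|lt_in].
      by rewrite updn; exact: anc_upd.
    by rewrite updE //; apply: anc_upd (ltnW lt_in) _; exact: (pre_anc P).
- move=> i g w; rewrite leq_eqVlt => /predU1P[->|]; first by exists 0%N.
  rewrite ltnS => le_in; rewrite updE // => gi ng.
  have ng' : ~ visited n e g.
    move=> [l /andP[l0 le_ln] el]; apply: ng; exists l; first by rewrite l0 leqW.
    by rewrite updE.
  apply: anc_jn => //; last exact: ex gi ng'.
  by apply: jmax; apply/asboolP; split => //; exists g, w.
Qed.

End Step.
End DepthFirst.

(** * The search exhausts the tree; choice of a leaf as root *)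

Section Spanning.
Variables (R : realType) (X : topologicalType) (V : set X) (E : finType)
  (phi : E -> R -> X).
Hypothesis hG : is_tree V phi.

Let G : is_graph V phi. Proof. by case: hG. Qed.

Let cell e : set X := phi e @` `[0, 1].

Lemma cell_closed e : closed (cell e).
Proof.
apply: (compact_closed (graph_hausdorff G)).
by apply: continuous_compact; [exact: graph_continuous G e|exact: segment_compact].
Qed.

Lemma edge_pointP e t : t \in `[0, 1]%R ->
  [\/ phi e t = phi e 0, phi e t = phi e 1 | 0 < t < 1].
Proof.
rewrite in_itv /= => /andP[]; rewrite !le_eqVlt => /predU1P[<- _|t0]; first by constructor 1.
by case/predU1P => [->|t1]; [constructor 2|constructor 3; rewrite t0].
Qed.

Lemma vertex_in_cell f x : V x -> cell f x -> exists v, joins phi f x v.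
Proof.
move=> Vx [t /= /(edge_pointP f)[] tE fx].
- by exists (phi f 1); left; rewrite -fx tE.
- by exists (phi f 0); right; rewrite -fx tE.
- by case: (graph_cells_vertices G (e := f) tE); rewrite fx.
Qed.

Lemma cells_meet e f x : cell e x -> cell f x -> e = f \/ V x.
Proof.
move=> [s /= /(edge_pointP e) sI <-] [t /= /(edge_pointP f) tI fet].
have [[Ve0 Ve1] [Vf0 Vf1]] := (graph_ends G e, graph_ends G f).
case: sI => es; [by right; rewrite es|by right; rewrite es|].
case: tI => ft; [by right; rewrite -fet ft|by right; rewrite -fet ft|].
by left; apply: (graph_cells_disjoint G es ft).
Qed.

(** The graph is connected, while the visited part [B] and the remaining part [C] are disjoint
    closed sets covering it; they are closed because the graph is finite. *)
Lemma preorder_exhausts n q e pa : preorder V phi n q e pa ->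
  (forall j f v, (j <= n)%N -> joins phi f (q j) v -> visited n e f) ->
  (forall f, visited n e f) /\ (forall v, V v -> exists2 i, (i <= n)%N & q i = v).
Proof.
move=> P noext.
pose Q := [set q i | i in [set i | (i <= n)%N]].
(* The root is added separately because no edge is visited when [n = 0]; every other numbered vertex
   is an end of a visited edge. *)
pose B := [set q 0%N] `|` \bigcup_(f in visited n e) cell f.
pose C := (V `\` Q) `|` \bigcup_(f in ~` visited n e) cell f.
have fin1 : finite_set V by case: hG.
have acc := hausdorff_accessible (graph_hausdorff G).
have fincl A : finite_set A -> closed (A : set X).
  by have /accessible_finite_set_closed := acc; apply.
have cB : closed B.
  apply: closedU; first exact: accessible_closed_set1.
  by apply: closed_bigcup => [|f _]; [exact: finite_finset|exact: cell_closed].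
have cC : closed C.
  apply: closedU; first by apply: fincl; exact: finite_setD.
  by apply: closed_bigcup => [|f _]; [exact: finite_finset|exact: cell_closed].
have Vq i : (i <= n)%N -> V (q i).
  case: i => [|i] le_in; first by case: (pre_root P).
  have ii : (0 < i.+1 <= n)%N by [].
  by have [] := joins_vertex hG (pre_joins P ii).
have cellQ i f : (i <= n)%N -> cell f (q i) -> visited n e f.
  by move=> le_in /(vertex_in_cell (Vq _ le_in))[v]; exact: noext.
have endQ x f : V x -> visited n e f -> cell f x -> Q x.
  move=> Vx [i ii <-] /(vertex_in_cell Vx)[v].
  have /andP[i0 le_in] := ii.
  have le_p : (pa i <= n)%N by rewrite (leq_trans (ltnW (pre_pa P ii)) le_in).
  by case/(joins_ends (pre_joins P ii)) => -[-> _]; [exists (pa i)|exists i].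
have BC x : B x -> ~ C x.
  case=> [->|[f vf fx]] [[Vx nQx]|[g ng gx]].
  - by apply: nQx; exists 0%N.
  - by apply: ng; exact: cellQ gx.
  - by apply: nQx; exact: endQ vf fx.
  - case: (cells_meet fx gx) => [fg|Vx]; first by apply: ng; rewrite -fg.
    have [i le_in qi] := endQ _ _ Vx vf fx.
    by apply: ng; apply: (cellQ i) => //; rewrite qi.
have BUC x : B x \/ C x.
  case: (graph_cover G x) => [Vx|[f [t [/andP[t0 t1] fx]]]].
    case: (pselect (Q x)) => [[[|i] le_in <-]|nQ]; [by left; left| |by right; left].
    left; right; exists (e i.+1); first by exists i.+1.
    have ii : (0 < i.+1 <= n)%N by [].
    case: (pre_joins P ii) => [[_ <-]|[<- _]].
      by exists 1 => //=; rewrite in_itv /= ler01 lexx.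
    by exists 0 => //=; rewrite in_itv /= ler01 lexx.
  have fx' : cell f x by exists t => //=; rewrite in_itv /= !ltW.
  by case: (pselect (visited n e f)) => vf; [left|right]; right; exists f.
have BT : B = setT.
  apply: (graph_connected G).
  - by exists (q 0%N); left.
  - exists (~` C); first exact: closed_openC.
    rewrite setTI; apply/seteqP; split=> x; first by move=> Bx Cx; exact: (BC x).
    by move=> nC; case: (BUC x).
  - by exists B => //; rewrite setTI.
have nC x : ~ C x by move=> Cx; apply: (BC x) => //; rewrite BT.
split=> [f|v Vv]; apply: contrapT => nv.
  apply: (nC (phi f 0)); right; exists f => //.
  by exists 0 => //=; rewrite in_itv /= ler01 lexx.
by apply: (nC v); left; split => // -[i le_in qi]; apply: nv; exists i.
Qed.

(** A preorder has at most [#|E|] edges, so a longest one satisfying the invariant exists; by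
    [preorder_step] no unvisited edge is left at its vertices. *)
Lemma preorder_exists v0 : V v0 -> exists n q e pa,
  [/\ preorder V phi n q e pa, q 0%N = v0, forall f, visited n e f &
      forall v, V v -> exists2 i, (i <= n)%N & q i = v].
Proof.
move=> Vv0.
have [e0] := graph_has_edge G.
pose S n := `[< exists q e pa,
  [/\ preorder V phi n q e pa, exhausted phi n q e pa & q 0%N = v0] >].
have S0 : exists n, S n.
  exists 0%N; apply/asboolP; exists (fun=> v0), (fun=> e0), (fun=> 0%N); split => //.
  - split=> // [i|i|i j]; rewrite ?leqn0; [by case: i|by case: i|].
    by move=> /eqP-> /eqP->.
  - by move=> j f v; rewrite leqn0 => /eqP-> _ _; exact: ancestor_refl.
have Sb n : S n -> (n <= #|E|)%N.
  by move/asboolP => [q [e [pa [P _ _]]]]; exact: preorder_card P.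
case: (ex_maxnP S0 Sb) => n /asboolP[q [e [pa [P ex q0]]]] nmax.
exists n, q, e, pa.
have [|ev vv] := preorder_exhausts P; last by split.
move=> j f v le_jn fj; apply: contrapT => nf.
have [q' [e' [pa' [P' ex' q'0]]]] := preorder_step hG P ex le_jn fj nf.
suff /nmax : S n.+1 by rewrite ltnn.
by apply/asboolP; exists q', e', pa'; split => //; rewrite q'0.
Qed.

(* The last vertex of a preorder is a leaf; restarting from it makes the root
   a leaf. *)
Lemma leaf_rooted_preorder : exists n q e pa,
  [/\ preorder V phi n q e pa, (0 < n)%N,
    forall i, (1 < i <= n)%N -> (0 < pa i)%N,
    forall f, visited n e f & forall v, V v -> exists2 i, (i <= n)%N & q i = v].
Proof.
have [e0] := graph_has_edge G.
have [V0 V1] := graph_ends G e0.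
have [n [q [e [pa [P q0 ev vv]]]]] := preorder_exists V0.
have n0 : (0 < n)%N by have [i /andP[i0 /(leq_trans i0)]] := ev e0.
have Vn : V (q n).
  have nn : (0 < n <= n)%N by rewrite n0 leqnn.
  by have [] := joins_vertex hG (pre_joins P nn).
(* Since [pa i < i <= n], the last vertex is never a parent, so [e n] is the only edge at it. *)
have leaf f v : joins phi f (q n) v -> f = e n.
  have [i ii <-] := ev f.
  have /andP[i0 le_in] := ii; have lt_p := pre_pa P ii.
  case/(joins_ends (pre_joins P ii)) => -[/(pre_inj P) + _]; last by move=> ->.
  by move/(_ (leqnn n)); lia.
have [m [q' [e' [pa' [P' q'0 ev' vv']]]]] := preorder_exists Vn.
have m0 : (0 < m)%N by have [i /andP[i0 /(leq_trans i0)]] := ev' e0.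
exists m, q', e', pa'; split => // i /andP[i1 le_im].
(* A second child [i] of the new root would be reached through the same edge as the child [1]. *)
rewrite lt0n; apply/eqP => pi0.
have ii : (0 < i <= m)%N by rewrite (ltnW i1).
have i1' : (0 < 1 <= m)%N by [].
have p10 : pa' 1%N = 0%N by have := pre_pa P' i1'; case: (pa' 1%N).
have := pre_joins P' ii; rewrite pi0 q'0 => /leaf ei.
have := pre_joins P' i1'; rewrite p10 q'0 => /leaf e1.
have := preorder_edge_inj P' ii i1'; rewrite ei e1 => /(_ erefl) i1E.
by rewrite i1E in i1.
Qed.

End Spanning.

(** * Paths from the root *)

Section Arm.
Variables (R : realType) (X : topologicalType) (V : set X) (E : finType)
  (phi : E -> R -> X).
Hypothesis hG : is_tree V phi.

Let G : is_graph V phi. Proof. by case: hG. Qed.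

(** [phi e] is only known to be continuous on [[0, 1]]; clamping the argument gives maps continuous
    on all of [R]. *)
Let clip (t : R) : R := Num.max 0 (Num.min 1 t).

Let clip_in t : clip t \in `[0, 1]%R.
Proof. by rewrite in_itv /= /clip le_max lexx /= ge_max ler01 /= ge_min lexx. Qed.

Let clip_id t : t \in `[0, 1]%R -> clip t = t.
Proof. by rewrite in_itv /= => /andP[t0 t1]; rewrite /clip min_r // max_r. Qed.

Let clip_continuous : continuous clip.
Proof.
move=> t; apply: continuous_max; first exact: cvg_cst.
by apply: continuous_min; [exact: cvg_cst|exact: cvg_id].
Qed.

Lemma edge_clip_continuous f (u : R -> R) : continuous u ->
  continuous (fun x => phi f (clip (u x))).
Proof.
move=> cu x; have cphi := graph_continuous G (e := f).
have /subspace_continuousP/(_ (clip (u x)) (clip_in _)) cvgphi := cphi.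
apply: (@cvg_comp _ _ _ (clip \o u) (phi f) _
  (within [set` `[0, 1 : R]] (nbhs (clip (u x))))).
  have cc : (clip \o u) y @[y --> x] --> clip (u x).
    by apply: continuous_comp; [exact: cu|exact: clip_continuous].
  move=> A /cc; rewrite /= !nbhs_simpl /=; apply: filterS => y /= Ay.
  exact/Ay/clip_in.
exact: cvgphi.
Qed.

Lemma edge_arm f u v (a b : R) : joins phi f u v -> a < b ->
  exists p : R -> X, [/\ continuous p, p a = u /\ p b = v,
    forall x, a < x < b -> exists2 t, 0 < t < 1 & p x = phi f t,
    {in `[a, b]%R &, injective p} &
    forall t, t \in `[0, 1]%R -> exists2 x, x \in `[a, b]%R & p x = phi f t].
Proof.
move=> fuv lt_ab; have ba0 : 0 < b - a by rewrite subr_gt0.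
have ba_neq0 : b - a != 0 by rewrite gt_eqF.
pose r x := (x - a) / (b - a).
have rE x : x \in `[a, b]%R -> r x \in `[0, 1]%R.
  rewrite !in_itv /= /r => /andP[ax xb].
  by rewrite divr_ge0 ?subr_ge0 ?(ltW lt_ab) //= ler_pdivrMr // mul1r lerD2r.
have r_cont : continuous r.
  by move=> x; apply: cvgMl; apply: cvgB; [exact: cvg_id|exact: cvg_cst].
have r_inj x y : r x = r y -> x = y.
  by move/(mulIf (invr_neq0 ba_neq0))/addIr.
have rK t : r (a + t * (b - a)) = t by rewrite /r addrC addKr mulfK.
have rab t : t \in `[0, 1]%R -> a + t * (b - a) \in `[a, b]%R.
  rewrite !in_itv /= => /andP[t0 t1]; rewrite lerDl mulr_ge0 ?(ltW ba0) //=.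
  by rewrite -lerBrDl ler_piMl // ltW.
have ra : r a = 0 by rewrite /r subrr mul0r.
have rb : r b = 1 by rewrite /r divff.
have c0 : clip 0 = 0 by rewrite clip_id // in_itv /= lexx ler01.
have c1 : clip 1 = 1 by rewrite clip_id // in_itv /= lexx ler01.
have rlt x : a < x < b -> 0 < r x < 1.
  move=> /andP[ax xb]; rewrite divr_gt0 ?subr_gt0 //=.
  by rewrite ltr_pdivrMr // mul1r ltrD2r.
have cK x : a < x < b -> clip (r x) = r x.
  by move=> /andP[ax xb]; apply/clip_id/rE; rewrite in_itv /= !ltW.
have inj := graph_injective G (e := f).
case: fuv => -[fu fv].
  exists (fun x => phi f (clip (r x))); split.
  - exact: edge_clip_continuous.
  - by rewrite ra rb c0 c1.
  - by move=> x xab; exists (r x); rewrite ?cK ?rlt.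
  - move=> x y xab yab /(inj _ _ (clip_in _) (clip_in _)).
    by rewrite !clip_id ?rE // => /r_inj.
  - by move=> t t01; exists (a + t * (b - a)); rewrite ?rab // rK clip_id.
(* The edge is oriented from [v] to [u], so it is traversed backwards. *)
exists (fun x => phi f (clip (1 - r x))); split.
- apply: edge_clip_continuous => x; apply: cvgB; first exact: cvg_cst.
  exact: r_cont.
- by rewrite ra rb subr0 subrr c0 c1.
- move=> x /rlt/andP[r0 r1]; exists (1 - r x).
    by rewrite subr_gt0 r1 /= ltrBlDr ltrDl.
  by rewrite clip_id // in_itv /= subr_ge0 (ltW r1) /= lerBlDr lerDl ltW.
- move=> x y /rE + /rE; rewrite !in_itv /= => /andP[x0 x1] /andP[y0 y1].
  move=> /(inj _ _ (clip_in _) (clip_in _)).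
  rewrite !clip_id; first by move=> /addrI/oppr_inj/r_inj.
  + by rewrite in_itv /= subr_ge0 y1 /= lerBlDr lerDl.
  + by rewrite in_itv /= subr_ge0 x1 /= lerBlDr lerDl.
- move=> t t01; have t01' : 1 - t \in `[0, 1]%R.
    move: t01; rewrite !in_itv /= => /andP[t0 t1].
    by rewrite subr_ge0 t1 /= lerBlDr lerDl.
  exists (a + (1 - t) * (b - a)); first exact: rab.
  by rewrite rK subKr clip_id.
Qed.

End Arm.

(** * The root paths parametrized by height, and where they separate *)

Section Branches.
Variables (R : realType) (X : topologicalType) (V : set X) (E : finType)
  (phi : E -> R -> X).
Hypothesis hG : is_tree V phi.

Let G : is_graph V phi. Proof. by case: hG. Qed.

Variables (n : nat) (q : nat -> X) (e : nat -> E) (pa : nat -> nat).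
Hypotheses (P : preorder V phi n q e pa) (ev : forall f, visited n e f)
  (vv : forall v, V v -> exists2 i, (i <= n)%N & q i = v).

Variable h : nat -> R.
Hypothesis h_inc : {homo h : i j / (i < j)%N >-> i < j}.

Let h_le i j : (i <= j)%N -> h i <= h j.
Proof. by rewrite leq_eqVlt => /predU1P[->//|/h_inc/ltW]. Qed.

Let pa0 : pa 0%N = 0%N. Proof. by case: (pre_root P). Qed.

Let h_pa i : (0 < i <= n)%N -> h (pa i) < h i.
Proof. by move/(pre_pa P)/h_inc. Qed.

Let pa_le i : (i <= n)%N -> (pa i <= n)%N.
Proof.
by move=> le_in; apply: (leq_trans (iter_parent_le pa0 (pre_pa P) 1 le_in)).
Qed.

Lemma arms_exist : exists a : nat -> R -> X, forall i, (0 < i <= n)%N ->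
  [/\ continuous (a i), a i (h (pa i)) = q (pa i) /\ a i (h i) = q i,
    forall x, h (pa i) < x < h i -> exists2 t, 0 < t < 1 & a i x = phi (e i) t,
    {in `[h (pa i), h i]%R &, injective (a i)} &
    forall t, t \in `[0, 1]%R -> exists2 x, x \in `[h (pa i), h i]%R & a i x = phi (e i) t].
Proof.
suff /choice[a aP] : forall i, exists p : R -> X, (0 < i <= n)%N ->
  [/\ continuous p, p (h (pa i)) = q (pa i) /\ p (h i) = q i,
    forall x, h (pa i) < x < h i -> exists2 t, 0 < t < 1 & p x = phi (e i) t,
    {in `[h (pa i), h i]%R &, injective p} &
    forall t, t \in `[0, 1]%R -> exists2 x, x \in `[h (pa i), h i]%R & p x = phi (e i) t].
  by exists a.
move=> i; have [ii|_] := boolP (0 < i <= n)%N; last by exists (fun=> q 0%N).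
by have [p pP] := edge_arm hG (pre_joins P ii) (h_pa ii); exists p.
Qed.

Section WithArms.
Variable a : nat -> R -> X.
Hypothesis aP : forall i, (0 < i <= n)%N ->
  [/\ continuous (a i), a i (h (pa i)) = q (pa i) /\ a i (h i) = q i,
    forall x, h (pa i) < x < h i -> exists2 t, 0 < t < 1 & a i x = phi (e i) t,
    {in `[h (pa i), h i]%R &, injective (a i)} &
    forall t, t \in `[0, 1]%R -> exists2 x, x \in `[h (pa i), h i]%R & a i x = phi (e i) t].

(* The path from the root to the vertex [i], parametrized by height; the first
   argument is fuel. *)
Fixpoint climb (k i : nat) (x : R) : X :=
  if k is k'.+1 then
    if i == 0%N then q 0%N
    else if x <= h (pa i) then climb k' (pa i) x else a i x
  else q 0%N.

Definition branch i := climb i i.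

Lemma climb_fuel k i x : (i <= n)%N -> (i <= k)%N -> climb k i x = branch i x.
Proof.
rewrite /branch; elim/ltn_ind: i k => i IH [|k] le_in; first by rewrite leqn0 => /eqP ->.
case: i IH le_in => [|i] IH le_in le_ik //=.
have lt_p : (pa i.+1 < i.+1)%N by apply: (pre_pa P); rewrite le_in.
case: ifP => // _; rewrite !IH //; try exact: pa_le.
exact: leq_trans lt_p le_ik.
Qed.

Lemma branchE i x : (0 < i <= n)%N ->
  branch i x = if x <= h (pa i) then branch (pa i) x else a i x.
Proof.
case: i => // i ii; rewrite {1}/branch /=; case: ifP => // _.
rewrite climb_fuel //; first by apply: pa_le; case/andP: ii.
by have := pre_pa P ii.
Qed.

Lemma branch_top i : (i <= n)%N -> branch i (h i) = q i.
Proof.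
case: i => // i le_in; have ii : (0 < i.+1 <= n)%N by [].
by rewrite branchE // leNgt h_pa //=; have [_ []] := aP ii.
Qed.

Lemma branch_ancestor i j x : (i <= n)%N -> ancestor pa i j -> x <= h j ->
  branch i x = branch j x.
Proof.
move=> le_in [k <-]; elim: k i le_in => [//|k IH] i le_in; rewrite iterSr => xh.
case: (posnP i) => [i0|i0]; first by move: xh; rewrite i0 pa0; exact: IH.
rewrite branchE ?i0 // (le_trans xh); first by apply: IH => //; exact: pa_le.
by apply: h_le; apply: (ancestor_le pa0 (pre_pa P)); [exact: pa_le|exists k].
Qed.

Lemma branch_continuous i : (i <= n)%N -> continuous (branch i).
Proof.
elim/ltn_ind: i => i IH le_in.
case: (posnP i) => [->|i0]; first by move=> x; exact: cvg_cst.
have ii : (0 < i <= n)%N by rewrite i0.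
have [ca [apa _] _ _ _] := aP ii.
apply/continuous_closedP => A cA.
have -> : branch i @^-1` A = (branch (pa i) @^-1` A `&` [set x | x <= h (pa i)])
    `|` (a i @^-1` A `&` [set x | h (pa i) <= x]).
  apply/seteqP; split => x /=; rewrite (branchE x ii).
    by case: leP => [? ?|/ltW ? ?]; [left|right].
  case: leP => [xh [[]//|[ax hx]]|hx [[]//|[]//]].
  have xE : x = h (pa i) by apply/eqP; rewrite eq_le xh.
  by move: ax; rewrite xE branch_top ?pa_le // apa.
apply: closedU; apply: closedI.
- move: A cA; apply/continuous_closedP; apply: IH; last exact: pa_le.
  exact: pre_pa P _ ii.
- exact: closed_le.
- by move: A cA; apply/continuous_closedP.
- exact: closed_ge.
Qed.

Lemma ancestor_root i : (i <= n)%N -> ancestor pa i 0%N.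
Proof.
elim/ltn_ind: i => i IH le_in.
case: (posnP i) => [->|i0]; first exact: ancestor_refl.
apply: ancestor_trans (ancestor_parent pa i) _; apply: IH; last exact: pa_le.
by apply: (pre_pa P); rewrite i0.
Qed.

Lemma branch_root i : (i <= n)%N -> branch i (h 0%N) = q 0%N.
Proof. by move=> le_in; rewrite (branch_ancestor le_in (ancestor_root le_in)). Qed.

(** The half-open ranges [h (pa j) < x <= h j] assign every point other than the root to one arm, a
    vertex going to the arm that ends there; with [arm_inj], equality of points becomes equality of
    arms. *)
Lemma branch_owner i x : (i <= n)%N -> h 0%N < x -> x <= h i ->
  exists j, [/\ (0 < j <= n)%N, ancestor pa i j, h (pa j) < x, x <= h j &
    branch i x = a j x].
Proof.
elim/ltn_ind: i => i IH le_in x0 xi.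
have i0 : (0 < i)%N by case: (posnP i) xi => // ->; rewrite leNgt x0.
have ii : (0 < i <= n)%N by rewrite i0.
case: (leP x (h (pa i))) => xp; last first.
  by exists i; split => //; [exact: ancestor_refl|rewrite branchE // leNgt xp].
have [j [jj aj jx xj bj]] := IH _ (pre_pa P ii) (pa_le le_in) x0 xp.
exists j; split => //; first exact: ancestor_trans (ancestor_parent _ _) aj.
by rewrite branchE // xp.
Qed.

Lemma vertexq i : (i <= n)%N -> V (q i).
Proof.
case: i => [|i] le_in; first by case: (pre_root P).
have ii : (0 < i.+1 <= n)%N by [].
by have [] := joins_vertex hG (pre_joins P ii).
Qed.

Lemma arm_inj i j x y : (0 < i <= n)%N -> (0 < j <= n)%N ->
  h (pa i) < x <= h i -> h (pa j) < y <= h j -> a i x = a j y -> i = j /\ x = y.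
Proof.
move=> ii jj /andP[ix xi] /andP[jy yj] eij.
have [_ [_ ai] ri inji _] := aP ii; have [_ [_ aj] rj _ _] := aP jj.
suff ij : i = j.
  by subst j; split=> //; apply: inji => //; rewrite in_itv /= ltW.
have [/andP[_ le_in] /andP[_ le_jn]] := (ii, jj).
move: xi yj; rewrite !le_eqVlt => /predU1P[xh|xi] /predU1P[yh|yj].
- by apply: (pre_inj P) => //; rewrite -ai -aj -xh -yh.
- have [|t t01 at_] := rj y; first by rewrite jy.
  case: (graph_cells_vertices G (e := e j) t01).
  by rewrite -at_ -eij xh ai; exact: vertexq.
- have [|t t01 at_] := ri x; first by rewrite ix.
  case: (graph_cells_vertices G (e := e i) t01).
  by rewrite -at_ eij yh aj; exact: vertexq.
- have [|t t01 at_] := rj y; first by rewrite jy.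
  have [|s s01 as_] := ri x; first by rewrite ix.
  apply: (preorder_edge_inj P ii jj).
  by apply: (graph_cells_disjoint G s01 t01); rewrite -as_ -at_.
Qed.

Lemma arm_not_root i x : (0 < i <= n)%N -> h (pa i) < x <= h i -> a i x <> q 0%N.
Proof.
move=> ii /andP[ix]; have [_ [_ ai] ri _ _] := aP ii.
have /andP[i0 le_in] := ii.
rewrite le_eqVlt => /predU1P[->|xi]; first by rewrite ai => /(pre_inj P) h0; lia.
have [|t t01 -> e0] := ri x; first by rewrite ix.
by apply: (graph_cells_vertices G (e := e i) t01); rewrite e0; exact: vertexq.
Qed.

(** In preorder the descendants of a vertex have consecutive indices: if [l + 1 > i] descends from
    [i], so does its parent, which is an ancestor of [l]. *)
Lemma descendants_interval i l s : (l <= n)%N -> ancestor pa l i ->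
  (i <= s <= l)%N -> ancestor pa s i.
Proof.
move=> le_ln anc_li; elim: l le_ln anc_li s => [|l IH] le_ln anc_li s /andP[is_ sl].
  have [-> ->] : s = 0%N /\ i = 0%N by lia.
  exact: ancestor_refl.
move: sl; rewrite leq_eqVlt => /predU1P[->//|]; rewrite ltnS => sl.
case: (ancestorS anc_li) => [il|anc_pi]; first by lia.
apply: IH; [exact: ltnW| |by rewrite is_].
exact: ancestor_trans (pre_anc P le_ln) anc_pi.
Qed.

(** Equal points other than the root lie on one arm [k], and [k] is an ancestor of both [i] and [j].
    All indices from [k] to [j] then descend from [k], and so do the parents of those beyond [i],
    whence [x <= h k <= h (pa l)]. Conversely each step from [j] to [j + 1] keeps the point, because
    [pa j.+1] is on the path to [j]. *)
Lemma branch_eqP i j x y : (i <= j <= n)%N ->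
  h 0%N <= x <= h i -> h 0%N <= y <= h j ->
  branch i x = branch j y <->
  x = y /\ forall l, (i < l <= j)%N -> x <= h (pa l).
Proof.
move=> /andP[ij jn] /andP[x0 xi] /andP[y0 yj].
have le_in := leq_trans ij jn.
split=> [eb|[<- {yj y0}]]; last first.
  elim: j ij jn => [|j IH]; first by rewrite leqn0 => /eqP->.
  rewrite leq_eqVlt => /predU1P[->//|]; rewrite ltnS => ij jn xl.
  have xp : x <= h (pa j.+1) by apply: xl; rewrite ltnS ij leqnn.
  rewrite IH //; [|exact: ltnW|]; last first.
    by move=> l /andP[il lj]; apply: xl; rewrite il leqW.
  rewrite (branch_ancestor (ltnW jn) (pre_anc P jn) xp).
  by rewrite [RHS]branchE // xp.
move: x0 y0; rewrite !le_eqVlt => /predU1P[x0|x0] /predU1P[y0|y0].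
- split; first by rewrite -x0 -y0.
  by move=> l _; rewrite -x0; exact: h_le.
- have [k [kk _ ky yk bk]] := branch_owner jn y0 yj.
  case: (@arm_not_root k y kk); first by rewrite ky.
  by rewrite -bk -eb -x0 branch_root.
- have [k [kk _ ky yk bk]] := branch_owner le_in x0 xi.
  case: (@arm_not_root k x kk); first by rewrite ky.
  by rewrite -bk eb -y0 branch_root.
have [k [kk ak kx xk bk]] := branch_owner le_in x0 xi.
have [k' [kk' ak' kx' xk' bk']] := branch_owner jn y0 yj.
have [||kE xy] := arm_inj kk kk' _ _ (etrans (esym bk) (etrans eb bk')).
- by rewrite kx.
- by rewrite kx'.
split=> // l /andP[il lj]; subst k'.
have ki := ancestor_le pa0 (pre_pa P) le_in ak.
have anc_l : ancestor pa l k.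
  by apply: descendants_interval jn ak' _; rewrite lj andbT (leq_trans ki (ltnW il)).
case: (ancestorS anc_l) => [kl|anc_pl]; first by lia.
apply: (le_trans xk); apply/h_le.
apply: (ancestor_le pa0 (pre_pa P) _ anc_pl).
by apply: pa_le; exact: leq_trans lj jn.
Qed.

Lemma branch_surj z : exists i x, [/\ (i <= n)%N, h 0%N <= x <= h i & branch i x = z].
Proof.
case: (graph_cover G z) => [/vv[i le_in <-]|[f [t [/andP[t0 t1] <-]]]].
  by exists i, (h i); rewrite le_in h_le // lexx branch_top.
have [i ii <-] := ev f; have [_ [api ai] _ _ si] := aP ii.
have /andP[i0 le_in] := ii.
have [|x] := si t; first by rewrite in_itv /= !ltW.
rewrite in_itv /= => /andP[px xi] ax; exists i, x; split => //.
  by rewrite xi andbT (le_trans _ px) // h_le.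
rewrite branchE //; case: leP => // xp.
have xE : x = h (pa i) by apply/eqP; rewrite eq_le xp.
by rewrite -ax xE branch_top ?pa_le.
Qed.

End WithArms.
End Branches.

(** The heights are quantified after [n] and [pa] because they are chosen together with the boundary
    curves, which depend on the shape of the tree. The paths [b i] carry what the geometry uses of
    the graph. *)
Lemma tree_branches (R : realType) (X : topologicalType) (V : set X) (E : finType)
    (phi : E -> R -> X) : is_tree V phi ->
  exists (n : nat) (pa : nat -> nat),
  [/\ (0 < n)%N, forall i, (0 < i <= n)%N -> (pa i < i)%N &
      forall i, (1 < i <= n)%N -> (0 < pa i)%N] /\
  forall h : nat -> R, {homo h : i j / (i < j)%N >-> i < j} ->
  exists b : nat -> R -> X,
  [/\ forall i, (i <= n)%N -> continuous (b i),
      forall i j x y, (i <= j <= n)%N -> h 0%N <= x <= h i -> h 0%N <= y <= h j ->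
        b i x = b j y <-> x = y /\ forall l, (i < l <= j)%N -> x <= h (pa l),
      forall z, exists i x, [/\ (i <= n)%N, h 0%N <= x <= h i & b i x = z],
      forall v, V v -> exists2 i, (i <= n)%N & b i (h i) = v &
      forall i j, (j <= i <= n)%N -> ancestor pa i j -> V (b i (h j))].
Proof.
move=> hG; have [n [q [e [pa [P n0 pa1 ev vv]]]]] := leaf_rooted_preorder hG.
exists n, pa; split; first by split=> //; move=> *; exact: (pre_pa P).
move=> h h_inc; have [a aP] := arms_exist hG P h_inc.
exists (branch q pa h a); split.
- move=> *; exact: (branch_continuous P h_inc aP).
- move=> *; exact: (branch_eqP hG P h_inc aP).
- move=> *; exact: (branch_surj hG P ev vv h_inc aP).
- by move=> v /vv[i le_in <-]; exists i => //; exact: (branch_top P h_inc aP).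
- move=> i j /andP[ji le_in] anc_ij.
  rewrite (branch_ancestor P h_inc _ le_in anc_ij) // (branch_top P h_inc aP).
    exact: (vertexq hG P (leq_trans ji le_in)).
  exact: leq_trans ji le_in.
Qed.

(** * Parabolas in the plane *)

Section Plane.
Variable R : realType.
Implicit Types (x p v : 'rV[R]_2) (A B C : set 'rV[R]_2).

Lemma vec2E0 (a b : R) : vec2 a b 0 0 = a.
Proof. by rewrite mxE. Qed.

Lemma vec2E1 (a b : R) : vec2 a b 0 1 = b.
Proof. by rewrite mxE. Qed.

Lemma ord2P (P : 'I_2 -> Prop) : P 0 -> P 1 -> forall i, P i.
Proof.
move=> P0 P1 [[|[|//]] i2]; first by rewrite (_ : Ordinal _ = 0) //; exact/val_inj.
by rewrite (_ : Ordinal _ = 1) //; exact/val_inj.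
Qed.

Lemma ord2_cases (j : 'I_2) : j = 0 \/ j = 1.
Proof. by move: j; apply: ord2P; [left|right]. Qed.

Lemma row2P x p : x 0 0 = p 0 0 -> x 0 1 = p 0 1 -> x = p.
Proof. by move=> e0 e1; apply/rowP; apply: ord2P. Qed.

Definition vec2E := (vec2E0, vec2E1).

Lemma congruence_comp (f g : 'rV[R]_2 -> 'rV[R]_2) :
  congruence f -> congruence g -> congruence (f \o g).
Proof.
move=> cf cg; elim: cf => [//|c t f' _ IH|v f' _ IH|c t f' _ IH].
- exact: congruence_rotation IH.
- exact: congruence_translation IH.
- exact: congruence_reflection IH.
Qed.

Lemma rotationK (c : 'rV[R]_2) t : cancel (rotation c t) (rotation c (- t)).
Proof.
move=> x; have cs := sin2cos2 t; apply: row2P;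
  rewrite /rotation /= !(mxE, vec2E) cosN sinN /=; ring: cs.
Qed.

Lemma reflectionK (c : 'rV[R]_2) t : cancel (reflection c t) (reflection c t).
Proof.
move=> x; have cs := sin2cos2 (2 * t); apply: row2P;
  rewrite /reflection /= !(mxE, vec2E) /=; ring: cs.
Qed.

Lemma congruence_inv (g : 'rV[R]_2 -> 'rV[R]_2) : congruence g ->
  exists2 g', congruence g' & cancel g g' /\ cancel g' g.
Proof.
elim=> [|c t f _ [f' cf' [fK f'K]]|v f _ [f' cf' [fK f'K]]|c t f _ [f' cf' [fK f'K]]].
- by exists id; [exact: congruence_id|].
- exists (f' \o rotation c (- t)).
    exact: congruence_comp cf' (congruence_rotation c (- t) (congruence_id _)).
  split; apply: can_comp => //; first exact: rotationK.
  by have := @rotationK c (- t); rewrite opprK.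
- exists (f' \o translation (- v)).
    exact: congruence_comp cf' (congruence_translation (- v) (congruence_id _)).
  by split; apply: can_comp => // x; rewrite /translation ?addrK ?addrNK.
- exists (f' \o reflection c t).
    exact: congruence_comp cf' (congruence_reflection c t (congruence_id _)).
  by split; apply: can_comp => //; exact: reflectionK.
Qed.

Lemma congruent_refl A : congruent A A.
Proof. by exists id; [exact: congruence_id|rewrite image_id]. Qed.

Lemma congruent_sym A B : congruent A B -> congruent B A.
Proof.
move=> [g /congruence_inv[g' cg' [gK g'K]] <-]; exists g' => //.
by rewrite image_comp -[RHS]image_id; apply: eq_imagel => x _; exact: gK.
Qed.

Lemma congruent_trans B A C : congruent A B -> congruent B C -> congruent A C.
Proof.
move=> [g cg <-] [g' cg' <-]; exists (g' \o g); first exact: congruence_comp.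
by rewrite image_comp.
Qed.

(* The parabola with vertex [(t, c)] and axis parallel to the first axis. *)
Definition side_parabola (a c t : R) : set 'rV[R]_2 :=
  [set x | x 0 0 = a * (x 0 1 - c) ^+ 2 + t].

(** The axes are exchanged by the reflection in the diagonal when [0 <= a] and by a quarter turn
    when [a < 0]; a translation then matches the vertices. *)
Lemma side_parabola_congruent (a c t : R) p :
  congruent (side_parabola `|a| c t) [set x | x 0 1 = a * (x 0 0 - p 0 0) ^+ 2 + p 0 1].
Proof.
have [a0|a0] := leP 0 a.
- exists (translation (p - vec2 c t) \o (reflection 0 (pi / 4) \o id)).
    exact/congruence_translation/congruence_reflection/congruence_id.
  have e : 2 * (pi / 4) = pi / 2 :> R by field.
  have gE x : (translation (p - vec2 c t) \o (reflection 0 (pi / 4) \o id)) x =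
      vec2 (x 0 1 + (p 0 0 - c)) (x 0 0 + (p 0 1 - t)).
    apply: row2P; rewrite /translation /reflection /= e cos_pihalf sin_pihalf
      !(mxE, vec2E) /=; ring.
  apply/seteqP; split=> [_ [x xP <-]|y yP].
    move: xP; rewrite gE /side_parabola /= !vec2E => ->.
    by rewrite ger0_norm //; ring.
  exists (vec2 (y 0 1 - p 0 1 + t) (y 0 0 - p 0 0 + c)).
    move: yP; rewrite /side_parabola /= !vec2E => ->.
    by rewrite ger0_norm //; ring.
  by rewrite gE !vec2E; apply: row2P; rewrite !vec2E; ring.
- exists (translation (p + vec2 (- c) t) \o (rotation 0 (- (pi / 2)) \o id)).
    exact/congruence_translation/congruence_rotation/congruence_id.
  have gE x : (translation (p + vec2 (- c) t) \o (rotation 0 (- (pi / 2)) \o id)) x =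
      vec2 (x 0 1 + (p 0 0 - c)) (- x 0 0 + (p 0 1 + t)).
    apply: row2P; rewrite /translation /rotation /= cosN sinN cos_pihalf sin_pihalf
      !(mxE, vec2E) /=; ring.
  apply/seteqP; split=> [_ [x xP <-]|y yP].
    move: xP; rewrite gE /side_parabola /= !vec2E => ->.
    by rewrite ltr0_norm //; ring.
  exists (vec2 (- (y 0 1 - p 0 1 - t)) (y 0 0 - p 0 0 + c)).
    move: yP; rewrite /side_parabola /= !vec2E => ->.
    by rewrite ltr0_norm //; ring.
  by rewrite gE !vec2E; apply: row2P; rewrite !vec2E; ring.
Qed.

Lemma side_parabola_is_parabola (a c t : R) : 0 < a -> is_parabola (side_parabola a c t).
Proof.
move=> a0; exists a, 0; split; first by rewrite gt_eqF.
by rewrite -{1}(gtr0_norm a0); exact: side_parabola_congruent.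
Qed.

(** The sign [s] selects the side of the curve on which the polynomial is positive. *)
Definition side_poly (s a c t : R) : mpoly 2 R :=
  s *: (mpolyX R (mnm1 (0 : 'I_2)) -
    (a *: (mpolyX R (mnm1 (1 : 'I_2)) - mpolyC 2 c) ^+ 2 + mpolyC 2 t)).

Lemma peval_side_poly (s a c t : R) x :
  peval (side_poly s a c t) x = s * (x 0 0 - (a * (x 0 1 - c) ^+ 2 + t)).
Proof.
by rewrite /peval /side_poly mevalZ mevalB mevalD mevalZ rmorphXn /= mevalB !mevalXU !mevalC.
Qed.

(** The polynomial is affine in the first coordinate; for [s != 0] this constant derivative excludes
    singular points. *)
Lemma gradient_side_poly0 (s a c t : R) x : gradient (side_poly s a c t) x 0 0 = s.
Proof.
rewrite mxE /side_poly /peval mderivZ mderivB mderivD mderivZ expr2 mderivM !mderivB !mderivC.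
rewrite !mderivX !mnm1E /= !(mevalZ, mevalB, mevalD, mevalM, mevalC, meval0).
rewrite !(mul0r, subr0, mulr0, addr0) mul1r mevalX big1 ?mulr1 // => i _.
by rewrite mnmBE subnn expr0.
Qed.

Lemma peval_side_poly_eq0 (s a c t : R) x : s != 0 ->
  (peval (side_poly s a c t) x = 0) <-> side_parabola a c t x.
Proof.
move=> s0; rewrite peval_side_poly /side_parabola /=.
split=> [/eqP|->]; last by rewrite subrr mulr0.
by rewrite mulf_eq0 (negPf s0) subr_eq0 => /eqP.
Qed.

Lemma side_parabola_hypersurface (s a c t : R) : s != 0 ->
  real_algebraic_hypersurface (side_parabola a c t) (side_poly s a c t).
Proof.
move=> s0; split; last first.
  by move=> x _; apply: contra_neq s0 => g0; rewrite -(gradient_side_poly0 s a c t x) g0 mxE.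
have zE : zero_set (side_poly s a c t) = side_parabola a c t.
  by apply/seteqP; split=> x; rewrite /zero_set /= peval_side_poly_eq0.
exists (side_parabola a c t); rewrite zE //.
apply/seteqP; split=> [x Sx|x [y _ /connected_component_sub//]].
by exists x => //; exact: connected_component_refl.
Qed.

Lemma row2_continuous (T : topologicalType) (f g : T -> R) :
  continuous f -> continuous g -> continuous (fun t => vec2 (f t) (g t)).
Proof.
move=> cf cg t; apply/cvgrPdist_lt => e e0.
near=> s; rewrite /Num.Def.normr /= mx_normrE.
apply: bigmax_lt => // -[i j] _ /=; rewrite (ord1 i).
move: j; apply: ord2P; rewrite !mxE /=; near: s.
- by have /cvgrPdist_lt := cf t; apply.
- by have /cvgrPdist_lt := cg t; apply.
Unshelve. all: by end_near. Qed.

Lemma side_quad_continuous (T : topologicalType) (u w : T -> R) (s a c t : R) :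
  continuous u -> continuous w ->
  continuous (fun z => s * (u z - (a * (w z - c) ^+ 2 + t))).
Proof.
move=> cu cw; have cwc : continuous (fun z => w z - c).
  by move=> z; apply: cvgB; [exact: cw|exact: cvg_cst].
under eq_fun do rewrite expr2.
move=> z; apply: cvgM; first exact: cvg_cst.
apply: cvgB; first exact: cu.
apply: cvgD; last exact: cvg_cst.
apply: cvgM; first exact: cvg_cst.
by apply: cvgM; exact: cwc.
Qed.

Lemma peval_side_poly_continuous (s a c t : R) : continuous (peval (side_poly s a c t)).
Proof.
rewrite (_ : peval _ = fun x => s * (x 0 0 - (a * (x 0 1 - c) ^+ 2 + t))).
  by apply: side_quad_continuous; exact: coord_continuous.
by apply/funext => x; rewrite peval_side_poly.
Qed.

End Plane.

(** * Tangent spaces of parabolas *)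

Section Tangent.
Variable R : realType.
Implicit Types (p v : 'rV[R]_2) (M : set 'rV[R]_2).

Lemma is_derive_row2P (u : R -> 'rV[R]_2) (s : R) v :
  is_derive s (1 : R) u v <->
  is_derive s (1 : R) (fun r => u r 0 0) (v 0 0) /\
  is_derive s (1 : R) (fun r => u r 0 1) (v 0 1).
Proof.
split=> [[du <-]|[[d0 e0] [d1 e1]]].
  have /derivable_mxP dj := du.
  by rewrite derive_mx // !mxE; split; split.
have du : derivable u s 1.
  apply/derivable_mxP => i j; rewrite (ord1 i).
  have [->|->] := ord2_cases j; [exact: d0|exact: d1].
split=> //; rewrite derive_mx //; apply/rowP; apply: ord2P; rewrite mxE.
  exact: e0.
exact: e1.
Qed.

Lemma is_derive_quad (g : R -> R) (s dg a c t : R) : is_derive s (1 : R) g dg ->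
  is_derive s (1 : R) (fun r => a * (g r - c) ^+ 2 + t) (2 * a * (g s - c) * dg).
Proof.
move=> dg'; have d1 : is_derive s (1 : R) (g - cst c) dg.
  by apply: is_derive_eq; rewrite subr0.
have d2 : is_derive s (1 : R) (a \*: (g - cst c) ^+ 2 + cst t) (2 * a * (g s - c) * dg).
  apply: is_derive_eq; rewrite addr0 /= /GRing.scale /= expr1 -[(g - cst c) s]/(g s - c); ring.
suff <- : a \*: (g - cst c) ^+ 2 + cst t = (fun r => a * (g r - c) ^+ 2 + t) by [].
by apply/funext => r; rewrite [LHS]/=; congr (_ * _ + _); rewrite !expr2.
Qed.

Lemma is_derive_line (y w : R) : is_derive (0 : R) (1 : R) (fun s => y + s * w) w.
Proof.
suff <- : cst y + (w \*: id) = (fun s => y + s * w).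
  by apply: is_derive_eq; rewrite add0r /GRing.scale /= mulr1.
by apply/funext => s; rewrite mulrC.
Qed.

Definition straight_curve p v (s : R) : 'rV[R]_2 :=
  vec2 (p 0 0 + s * v 0 0) (p 0 1 + s * v 0 1).

Lemma straight_curve_tangent M p v :
  (\forall s \near (0 : R), M (straight_curve p v s)) -> tangent_space M p v.
Proof.
move=> Mu; exists (straight_curve p v).
  by split=> //; apply: row2P; rewrite vec2E mul0r addr0.
apply/is_derive_row2P; split; rewrite /straight_curve;
  under eq_fun do rewrite vec2E; exact: is_derive_line.
Qed.

Definition side_curve (a c t y w s : R) : 'rV[R]_2 :=
  vec2 (a * (y + s * w - c) ^+ 2 + t) (y + s * w).

Lemma side_curve_in a c t y w s : side_parabola a c t (side_curve a c t y w s).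
Proof. by rewrite /side_parabola /side_curve /= !vec2E. Qed.

(** [M] is left arbitrary so that the lemma also applies to strata, which contain the curve only
    near the point. *)
Lemma side_curve_tangent M a c t p v : side_parabola a c t p ->
  v 0 0 = 2 * a * (p 0 1 - c) * v 0 1 ->
  (\forall s \near (0 : R), M (side_curve a c t (p 0 1) (v 0 1) s)) -> tangent_space M p v.
Proof.
move=> pS vE Mu; exists (side_curve a c t (p 0 1) (v 0 1)).
  by split=> //; apply: row2P; rewrite vec2E mul0r addr0.
apply/is_derive_row2P; split; rewrite /side_curve.
  under eq_fun do rewrite vec2E.
  have := @is_derive_quad (fun s => p 0 1 + s * v 0 1) 0 (v 0 1) a c t (is_derive_line _ _).
  by rewrite mul0r addr0 -vE.
under eq_fun do rewrite vec2E; exact: is_derive_line.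
Qed.

Lemma tangent_side_parabola_sub M a c t p v : M `<=` side_parabola a c t ->
  tangent_space M p v -> v 0 0 = 2 * a * (p 0 1 - c) * v 0 1.
Proof.
move=> MS [u [u0 Mu] /is_derive_row2P[d0 d1]].
have dq := is_derive_quad a c t d1.
have : is_derive (0 : R) (1 : R) (fun r => u r 0 0) (2 * a * (u 0 0 1 - c) * v 0 1).
  apply: near_eq_is_derive dq.
  by near=> s; apply/esym/MS; near: s.
by rewrite u0 => -[_ <-]; case: d0.
Unshelve. all: by end_near. Qed.

Lemma tangent_side_parabola a c t p v : side_parabola a c t p ->
  tangent_space (side_parabola a c t) p v <-> v 0 0 = 2 * a * (p 0 1 - c) * v 0 1.
Proof.
move=> pS; split; first exact: (tangent_side_parabola_sub (fun x => id)).
move=> vE; apply: (side_curve_tangent pS vE).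
by near=> s; exact: side_curve_in.
Unshelve. all: by end_near. Qed.

Lemma line_has_dim (k : R) : has_dim [set v : 'rV[R]_2 | v 0 0 = k * v 0 1] 1.
Proof.
exists <[vec2 k 1]>%VS; split.
  rewrite dim_vline; suff -> : vec2 k 1 != 0 by []; apply/eqP => /rowP/(_ 1).
  by rewrite vec2E mxE => /eqP; rewrite oner_eq0.
move=> v; split=> [/vlineP[r ->]|/= vE]; first by rewrite /= !mxE /= mulr1 mulrC.
apply/vlineP; exists (v 0 1); apply: row2P; rewrite !mxE /=; last by rewrite mulr1.
by rewrite vE mulrC.
Qed.

Lemma two_lines_has_dim (k k' : R) : k != k' ->
  has_dim [set v : 'rV[R]_2 | v 0 0 = k * v 0 1 /\ v 0 0 = k' * v 0 1] 0.
Proof.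
move=> kk'; exists 0%VS; split; first exact: dimv0.
move=> v; rewrite memv0; split=> [/eqP->|/= [e e']]; first by rewrite /= !mxE !mulr0.
have v1 : v 0 1 = 0.
  apply/eqP; have : (k - k') * v 0 1 = 0 by rewrite mulrBl -e -e' subrr.
  by move/eqP; rewrite mulf_eq0 subr_eq0 (negPf kk').
by apply/eqP/row2P; rewrite ?e v1 mxE // mulr0.
Qed.

End Tangent.

(** * The boundary curves *)

Section QuadraticIdentities.
Variable R : comRingType.
Implicit Types a b c t y : R.

(** With equal leading coefficients the difference is affine, and it vanishes at [b]. *)
Lemma quad_diff a y b c c' t t' : a * (b - c) ^+ 2 + t = a * (b - c') ^+ 2 + t' ->
  (a * (y - c) ^+ 2 + t) - (a * (y - c') ^+ 2 + t') = 2 * a * (c' - c) * (y - b).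
Proof.
move=> e; have -> : t = a * (b - c') ^+ 2 + t' - a * (b - c) ^+ 2.
  by rewrite -e addrAC subrr add0r.
ring.
Qed.

(* The difference of two quadratics with leading coefficients [a] and [a'],
   through its values at [b] and [b']. *)
Lemma quad_interp a a' y b b' c t t' :
  (a * (y - c) ^+ 2 + t - (a' * (y - b) ^+ 2 + t')) * (b' - b) =
  (b' - y) * (a * (b - c) ^+ 2 + t - t') +
  (y - b) * (a * (b' - c) ^+ 2 + t - (a' * (b' - b) ^+ 2 + t')) +
  (a' - a) * (y - b) * (b' - y) * (b' - b).
Proof. ring. Qed.

(** The gap at [b] between an arc and a bottom curve that meet at [b'], the bottom having its vertex
    over [b]; the second factor bounds the slope [2 * a * (b' - c)] of the arc at [b']. *)
Lemma quad_end a a' b b' c t :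
  a * (b - c) ^+ 2 + t - (a * (b' - c) ^+ 2 + t - a' * (b' - b) ^+ 2) =
  (b' - b) * ((a + a') * (b' - b) - 2 * a * (b' - c)).
Proof. ring. Qed.

End QuadraticIdentities.

Definition arc (R : realType) (a : R) (c t : nat -> R) i (y : R) :=
  a * (y - c i) ^+ 2 + t i.

(** The vertex of this parabola is the root corner itself, so the curve only increases over the
    region and its one critical point is a corner. *)
Definition bottom (R : realType) (a' : R) (b h : nat -> R) (y : R) :=
  a' * (y - b 0%N) ^+ 2 + h 0%N.

(* The arcs [1, ..., n] form the graph of a function of [y] with corners at the
   breakpoints [b i], of height [h i]; the arc [i] has its vertex at [c i], at
   height [t i]. *)
Record profile (R : realType) (a a' : R) (n : nat) (b c t h : nat -> R) : Prop :=
    Profile {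
  prof_a_gt0 : 0 < a;
  prof_lt_a : a < a';
  prof_n_gt0 : (0 < n)%N;
  prof_b_inc : forall i, (i < n)%N -> b i < b i.+1;
  prof_lt_cb : forall i, (0 < i <= n)%N -> c i < b i;
  prof_le_bc : forall i, (0 < i < n)%N -> b i <= c i.+1;
  prof_lt_c1b0 : c 1%N < b 0%N;
  prof_right : forall i, (0 < i <= n)%N -> arc a c t i (b i) = h i;
  prof_left : forall i, (i < n)%N -> arc a c t i.+1 (b i) = h i;
  prof_end : a' * (b n - b 0%N) ^+ 2 = h n - h 0%N
}.

Section Profile.
Variables (R : realType) (a a' : R) (n : nat) (b c t h : nat -> R).
Hypothesis P : profile a a' n b c t h.

Local Notation arc := (arc a c t).
Local Notation bottom := (bottom a' b h).

Let a_gt0 := prof_a_gt0 P.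
Let lt_aa' := prof_lt_a P.
Let n_gt0 := prof_n_gt0 P.
Let b_inc := prof_b_inc P.
Let lt_cb := prof_lt_cb P.
Let le_bc := prof_le_bc P.
Let arc_right := prof_right P.
Let arc_left := prof_left P.
Let bottom_end := prof_end P.

Lemma b_lt i j : (i < j <= n)%N -> b i < b j.
Proof.
elim: j => // j IH; rewrite ltnS => /andP[]; rewrite leq_eqVlt => /predU1P[->|ij] jn.
  exact: b_inc.
by apply: (lt_trans _ (b_inc jn)); apply: IH; rewrite ij ltnW.
Qed.

Lemma b_le i j : (i <= j <= n)%N -> b i <= b j.
Proof.
move=> /andP[]; rewrite leq_eqVlt => /predU1P[->//|ij] jn.
by apply/ltW/b_lt; rewrite ij.
Qed.

Lemma c_inc i : (0 < i < n)%N -> c i < c i.+1.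
Proof.
move=> /andP[i0 lt_in]; apply: (@lt_le_trans _ _ (b i)).
  by apply: lt_cb; rewrite i0 ltnW.
by apply: le_bc; rewrite i0.
Qed.

Lemma arc_diff i y : (0 < i < n)%N ->
  arc i y - arc i.+1 y = 2 * a * (c i.+1 - c i) * (y - b i).
Proof.
move=> /andP[i0 lt_in].
have e : arc i (b i) = arc i.+1 (b i) by rewrite arc_right ?i0 ?(ltnW lt_in) // arc_left.
exact: quad_diff e.
Qed.

Lemma arc_lt_next i y : (0 < i < n)%N -> y < b i -> arc i y < arc i.+1 y.
Proof.
move=> ii yb; rewrite -subr_lt0 arc_diff // pmulr_rlt0 ?subr_lt0 //.
by rewrite !mulr_gt0 ?subr_gt0 ?c_inc ?ltr0n.
Qed.

Lemma arc_gt_next i y : (0 < i < n)%N -> b i < y -> arc i.+1 y < arc i y.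
Proof.
move=> ii yb; rewrite -subr_gt0 arc_diff // pmulr_rgt0 ?subr_gt0 //.
by rewrite !mulr_gt0 ?subr_gt0 ?c_inc ?ltr0n.
Qed.

Lemma arc_lt i j y : (0 < i)%N -> (i < j <= n)%N -> y < b i -> arc i y < arc j y.
Proof.
move=> i0; elim: j => // j IH; rewrite ltnS => /andP[].
rewrite leq_eqVlt => /predU1P[<-|ij] jn yb; first by apply: arc_lt_next; rewrite ?i0.
apply: (lt_trans (IH _ yb)); first by rewrite ij ltnW.
apply: arc_lt_next; first by rewrite (ltn_trans i0 ij).
by apply: (lt_trans yb); apply: b_lt; rewrite ij ltnW.
Qed.

Lemma arc_gt i j y : (0 < i)%N -> (i < j <= n)%N -> b j.-1 < y -> arc j y < arc i y.
Proof.
move=> i0; elim: j => // j IH; rewrite ltnS => /andP[].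
rewrite leq_eqVlt => /predU1P[<-|ij] jn yb; first by apply: arc_gt_next; rewrite ?i0.
have j0 := ltn_trans i0 ij.
apply: (@lt_trans _ _ (arc j y)); first by apply: arc_gt_next; rewrite ?j0.
apply: IH; first by rewrite ij ltnW.
by apply: le_lt_trans yb; apply: b_le; rewrite leq_pred ltnW.
Qed.

Lemma arc_le i j y : (0 < i)%N -> (i < j <= n)%N -> y <= b i -> arc i y <= arc j y.
Proof.
move=> i0 /andP[ij jn]; rewrite le_eqVlt => /predU1P[->|yb]; last first.
  by apply/ltW/arc_lt => //; rewrite ij.
rewrite arc_right ?i0 ?(ltnW (leq_trans ij jn)) // -arc_left ?(leq_trans ij jn) //.
move: ij; rewrite leq_eqVlt => /predU1P[->//|ij].
apply/ltW/arc_lt => //; first by rewrite ij.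
exact/b_inc/(leq_trans _ jn)/ltnW.
Qed.

Lemma arc_ge i j y : (0 < i)%N -> (i < j <= n)%N -> b j.-1 <= y -> arc j y <= arc i y.
Proof.
move=> i0 /andP[ij jn]; rewrite le_eqVlt => /predU1P[<-|yb]; last first.
  by apply/ltW/arc_gt => //; rewrite ij.
case: j ij jn => // j ij jn /=; rewrite arc_left //.
move: ij; rewrite ltnS leq_eqVlt => /predU1P[ij|ij]; first by subst j; rewrite arc_right ?i0 ?(ltnW jn).
rewrite -[h j]arc_right ?(ltn_trans i0 ij) ?(ltnW jn) //.
apply/ltW/arc_gt => //; first by rewrite ij ltnW.
by case: j ij jn => // j ij jn /=; apply: b_inc; rewrite ltnW.
Qed.

(** Differences of consecutive arcs are affine and change sign at the breakpoints, because the [c i]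
    increase; so the minimum of all arcs is the arc [i] over the [i]-th interval. *)
Lemma arc_min i j y : (0 < i <= n)%N -> (0 < j <= n)%N -> b i.-1 <= y <= b i ->
  arc i y <= arc j y.
Proof.
move=> /andP[i0 le_in] /andP[j0 jn] /andP[by_ yb].
case: (ltngtP i j) => [ij|ji|->//]; first by apply: arc_le => //; rewrite ij.
by apply: arc_ge => //; rewrite ji.
Qed.

Lemma breakpoint_locate y : b 0%N <= y <= b n ->
  exists2 i, (0 < i <= n)%N & b i.-1 <= y <= b i.
Proof.
move=> /andP[b0y]; elim: n n_gt0 => // m IH _ yb.
case: (leP (b m) y) => [bmy|/ltW ybm].
  by exists m.+1; rewrite ?leqnn //= bmy.
case: (posnP m) => [m0|m0]; last first.
  by have [i /andP[i0 im] iy] := IH m0 ybm; exists i; rewrite // i0 leqW.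
by exists 1%N => //=; move: yb ybm; rewrite m0 b0y => ->.
Qed.

Let width_gt0 : 0 < b n - b 0%N.
Proof. by rewrite subr_gt0; apply: b_lt; rewrite n_gt0 leqnn. Qed.

Lemma bottom0 : bottom (b 0%N) = h 0%N.
Proof. by rewrite /bottom subrr expr0n mulr0 add0r. Qed.

Lemma bottomn : bottom (b n) = h n.
Proof. by rewrite /bottom bottom_end addrNK. Qed.

Lemma bottom_le_arc0 k : (0 < k <= n)%N -> h 0%N <= arc k (b 0%N).
Proof.
move=> kk; rewrite -arc_left //; apply: arc_min => //.
by rewrite lexx /=; apply: b_le; rewrite n_gt0.
Qed.

Lemma bottom_le_arcn k : (0 < k <= n)%N -> h n <= arc k (b n).
Proof.
move=> kk; rewrite -arc_right ?n_gt0 ?leqnn //; apply: arc_min => //.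
  by rewrite n_gt0 leqnn.
by rewrite lexx andbT; apply: b_le; rewrite leq_pred leqnn.
Qed.

(** Over the region the first two terms are nonnegative and the last one, due to [a < a'], is
    positive between the extreme corners. Multiplying by the width avoids a division. *)
Lemma gap_interp k y : (arc k y - bottom y) * (b n - b 0%N) =
  (b n - y) * (arc k (b 0%N) - h 0%N) + (y - b 0%N) * (arc k (b n) - h n) +
  (a' - a) * (y - b 0%N) * (b n - y) * (b n - b 0%N).
Proof.
have e : h n = a' * (b n - b 0%N) ^+ 2 + h 0%N by rewrite bottom_end addrNK.
by rewrite e; exact: quad_interp.
Qed.

Lemma bottom_lt_arc k y : (0 < k <= n)%N -> b 0%N < y < b n -> bottom y < arc k y.
Proof.
move=> kk /andP[y0 yn]; rewrite -subr_gt0 -(pmulr_lgt0 _ width_gt0) gap_interp.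
apply: ltr_wpDl.
  by rewrite addr_ge0 // mulr_ge0 // subr_ge0 ?(ltW y0) ?(ltW yn)
    ?bottom_le_arc0 ?bottom_le_arcn.
by rewrite !mulr_gt0 // subr_gt0.
Qed.

Lemma bottom_le_arc k y : (0 < k <= n)%N -> b 0%N <= y <= b n -> bottom y <= arc k y.
Proof.
move=> kk /andP[]; rewrite le_eqVlt => /predU1P[<- _|y0].
  by rewrite bottom0 bottom_le_arc0.
rewrite le_eqVlt => /predU1P[->|yn]; first by rewrite bottomn bottom_le_arcn.
by apply/ltW/bottom_lt_arc => //; rewrite y0.
Qed.

(** Beyond [b 0] the first arc, and beyond [b n] the last one, falls below the bottom: their gap
    vanishes at that end and is strictly concave. The region is thus bounded without further
    curves. *)
Lemma region_bounds y : (forall k, (0 < k <= n)%N -> bottom y <= arc k y) ->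
  b 0%N <= y <= b n.
Proof.
move=> gm; have k1 : (0 < 1 <= n)%N by rewrite n_gt0.
have kn : (0 < n <= n)%N by rewrite n_gt0 leqnn.
apply/andP; split; rewrite leNgt; apply/negP => yl.
  have := gm _ k1; rewrite -subr_ge0 -(pmulr_lge0 _ width_gt0) gap_interp.
  rewrite arc_left // subrr mulr0 add0r leNgt => /negP; apply.
  have yn : y < b n by apply: (lt_trans yl); apply: b_lt; rewrite n_gt0 leqnn.
  apply: ltr_wnDl; first by rewrite mulr_le0_ge0 ?subr_le0 ?subr_ge0 ?(ltW yl) ?bottom_le_arcn.
  by rewrite pmulr_llt0 // pmulr_llt0 ?subr_gt0 // pmulr_rlt0 ?subr_lt0 ?subr_gt0.
have := gm _ kn; rewrite -subr_ge0 -(pmulr_lge0 _ width_gt0) gap_interp.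
rewrite (@arc_right n) // subrr mulr0 addr0 leNgt => /negP; apply.
have y0 : b 0%N < y by apply: (lt_trans _ yl); apply: b_lt; rewrite n_gt0 leqnn.
apply: ltr_wnDl; first by rewrite mulr_le0_ge0 ?subr_le0 ?subr_ge0 ?(ltW yl) ?bottom_le_arc0.
by rewrite pmulr_llt0 // pmulr_rlt0 ?subr_lt0 // mulr_gt0 // subr_gt0.
Qed.

(** Transversality at the last corner. As the arc [n] is not below the bottom at [b 0], its slope at
    [b n] is at most [(a + a') * (b n - b 0)], which is less than the slope of the bottom. *)
Lemma end_slopes : 2 * a * (b n - c n) < 2 * a' * (b n - b 0%N).
Proof.
have kn : (0 < n <= n)%N by rewrite n_gt0 leqnn.
have := bottom_le_arc0 kn; rewrite -subr_ge0.
have e : h 0%N = arc n (b n) - a' * (b n - b 0%N) ^+ 2.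
  by rewrite arc_right // bottom_end opprB addrC subrK.
have -> : arc n (b 0%N) - h 0%N =
    (b n - b 0%N) * ((a + a') * (b n - b 0%N) - 2 * a * (b n - c n)).
  by rewrite e; exact: quad_end.
rewrite pmulr_rge0 // subr_ge0 => /le_lt_trans; apply.
by rewrite ltr_pM2r // mulrDl mul1r ltrD2r.
Qed.

Lemma bottom_incr y y' : b 0%N <= y -> y <= y' -> bottom y <= bottom y'.
Proof.
move=> y0 yy'; rewrite lerD2r ler_wpM2l ?(ltW (lt_trans a_gt0 lt_aa')) //.
by rewrite ler_sqr ?nnegrE ?subr_ge0 ?lerD2r // (le_trans y0).
Qed.

Lemma arc_incr i y y' : c i <= y -> y <= y' -> arc i y <= arc i y'.
Proof.
move=> y0 yy'; rewrite lerD2r ler_wpM2l ?(ltW a_gt0) //.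
by rewrite ler_sqr ?nnegrE ?subr_ge0 ?lerD2r // (le_trans y0).
Qed.

Lemma arc_decr i y y' : y' <= c i -> y <= y' -> arc i y' <= arc i y.
Proof.
move=> y0 yy'; rewrite lerD2r ler_wpM2l ?(ltW a_gt0) //.
rewrite -[(y' - _) ^+ 2]sqrrN -[(y - _) ^+ 2]sqrrN.
by rewrite ler_sqr ?nnegrE ?opprB ?subr_ge0 ?lerD2l ?lerN2 // (le_trans yy').
Qed.

Lemma arc_ge_vertex i y : t i <= arc i y.
Proof. by rewrite lerDr mulr_ge0 ?(ltW a_gt0) // sqr_ge0. Qed.

End Profile.

(** * The region *)

Section ShearIdentities.
Variable R : comRingType.
Implicit Types a c t x y s : R.

(** The path is a segment after the shear, where an arc is a line: its defining function is affine
    in [s]. That of the bottom, in the next identity, has a concave surplus with factor [a' - a]. *)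
Lemma shear_arc a c t x0 y0 x1 y1 s :
  a * (y0 + s * (y1 - y0) - c) ^+ 2 + t -
    (x0 - a * y0 ^+ 2 + s * (x1 - a * y1 ^+ 2 - (x0 - a * y0 ^+ 2)) +
     a * (y0 + s * (y1 - y0)) ^+ 2) =
  (1 - s) * (a * (y0 - c) ^+ 2 + t - x0) + s * (a * (y1 - c) ^+ 2 + t - x1).
Proof. ring. Qed.

Lemma shear_bottom a a' c t x0 y0 x1 y1 s :
  x0 - a * y0 ^+ 2 + s * (x1 - a * y1 ^+ 2 - (x0 - a * y0 ^+ 2)) +
     a * (y0 + s * (y1 - y0)) ^+ 2 - (a' * (y0 + s * (y1 - y0) - c) ^+ 2 + t) =
  (1 - s) * (x0 - (a' * (y0 - c) ^+ 2 + t)) + s * (x1 - (a' * (y1 - c) ^+ 2 + t)) +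
  (a' - a) * (s * (1 - s)) * (y1 - y0) ^+ 2.
Proof. ring. Qed.

End ShearIdentities.

Section Region.
Variables (R : realType) (a a' : R) (n : nat) (b c t h : nat -> R).
Hypothesis P : profile a a' n b c t h.
Implicit Types p q : 'rV[R]_2.

Local Notation arc := (arc a c t).
Local Notation bottom := (bottom a' b h).

Let a_gt0 := prof_a_gt0 P.
Let lt_aa' := prof_lt_a P.
Let n_gt0 := prof_n_gt0 P.

(* The index [0] stands for the curve [bottom], the other ones for the arcs. *)
Definition side_sign (l : 'I_n.+1) : R := if l == 0 :> nat then 1 else -1.
Definition side_coef (l : 'I_n.+1) : R := if l == 0 :> nat then a' else a.
Definition side_mid (l : 'I_n.+1) : R := if l == 0 :> nat then b 0%N else c l.
Definition side_tip (l : 'I_n.+1) : R := if l == 0 :> nat then h 0%N else t l.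

Definition side l := side_parabola (side_coef l) (side_mid l) (side_tip l).
Definition side_eqn l := side_poly (side_sign l) (side_coef l) (side_mid l) (side_tip l).
Definition slope l (y : R) := 2 * side_coef l * (y - side_mid l).

Definition region : set 'rV[R]_2 := [set p | forall l, 0 < peval (side_eqn l) p].
Definition cregion : set 'rV[R]_2 := [set p | forall l, 0 <= peval (side_eqn l) p].

Lemma side_sign_neq0 l : side_sign l != 0.
Proof. by rewrite /side_sign; case: ifP => _; rewrite ?oppr_eq0 oner_eq0. Qed.

Lemma side_coef_gt0 l : 0 < side_coef l.
Proof. by rewrite /side_coef; case: ifP => // _; exact: lt_trans lt_aa'. Qed.

Lemma sideP l p : side l p <-> peval (side_eqn l) p = 0.
Proof. by apply: iff_sym; apply: peval_side_poly_eq0; exact: side_sign_neq0. Qed.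

Lemma peval_side0 p : peval (side_eqn ord0) p = p 0 0 - bottom (p 0 1).
Proof. by rewrite peval_side_poly mul1r. Qed.

Lemma peval_sideS (l : 'I_n.+1) p : (0 < l)%N ->
  peval (side_eqn l) p = arc l (p 0 1) - p 0 0.
Proof.
rewrite lt0n => /negPf l0; rewrite peval_side_poly /side_sign /side_coef /side_mid /side_tip l0.
by rewrite mulN1r opprB.
Qed.

Lemma side_indexP (Q : 'I_n.+1 -> Prop) :
  Q ord0 -> (forall k (kn : (k <= n)%N), (0 < k)%N -> Q (Ordinal (kn : (k < n.+1)%N))) ->
  forall l, Q l.
Proof.
move=> Q0 QS [[|k] kn]; last exact: QS.
by rewrite (_ : Ordinal kn = ord0) //; exact/val_inj.
Qed.

Lemma regionP p : region p <->
  bottom (p 0 1) < p 0 0 /\ forall k, (0 < k <= n)%N -> p 0 0 < arc k (p 0 1).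
Proof.
split=> [rp|[p0 pk]]; last first.
  apply: side_indexP => [|k kn k0]; first by rewrite peval_side0 subr_gt0.
  by rewrite peval_sideS // subr_gt0; apply: pk; rewrite k0.
split=> [|k /andP[k0 kn]]; first by have := rp ord0; rewrite peval_side0 subr_gt0.
by have := rp (Ordinal (kn : (k < n.+1)%N)); rewrite peval_sideS // subr_gt0.
Qed.

Lemma cregionP p : cregion p <->
  bottom (p 0 1) <= p 0 0 /\ forall k, (0 < k <= n)%N -> p 0 0 <= arc k (p 0 1).
Proof.
split=> [rp|[p0 pk]]; last first.
  apply: side_indexP => [|k kn k0]; first by rewrite peval_side0 subr_ge0.
  by rewrite peval_sideS // subr_ge0; apply: pk; rewrite k0.
split=> [|k /andP[k0 kn]]; first by have := rp ord0; rewrite peval_side0 subr_ge0.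
by have := rp (Ordinal (kn : (k < n.+1)%N)); rewrite peval_sideS // subr_ge0.
Qed.

Lemma cregion_width p : cregion p -> b 0%N <= p 0 1 <= b n.
Proof.
move=> /cregionP[p0 pk]; apply: (region_bounds P) => k kk.
exact: le_trans p0 (pk _ kk).
Qed.

Lemma side_near_pos l p : 0 < peval (side_eqn l) p ->
  \forall q \near p, 0 < peval (side_eqn l) q.
Proof.
move=> pl; have cf : continuous (peval (side_eqn l)) by exact: peval_side_poly_continuous.
exact: (cvgr_gt (FF := nbhs_filter p) _ (cf p) _ pl).
Qed.

Lemma region_open : open region.
Proof.
rewrite openE => p rp.
suff : \forall q \near p, forall l, 0 < peval (side_eqn l) q by [].
by apply: (filter_forall (nbhs_filter p)) => l; exact/side_near_pos/rp.
Qed.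

Lemma cregion_closed : closed cregion.
Proof.
rewrite (_ : cregion = \bigcap_(l in setT) (peval (side_eqn l) @^-1` [set x | 0 <= x])).
  apply: closed_bigI => l _; have cf : continuous (peval (side_eqn l)) by exact: peval_side_poly_continuous.
  by move/continuous_closedP: cf; apply; exact: closed_ge.
by apply/seteqP; split=> [p rp l _|p rp l]; [exact: rp|exact: (rp l I)].
Qed.

(* The shear [(x, y) -> (x - a * y ^ 2, y)] turns the arcs into lines and the
   bottom curve into a convex one; [shear_path] is the preimage of a segment. *)
Definition shear_path p q (s : R) : 'rV[R]_2 :=
  let y := p 0 1 + s * (q 0 1 - p 0 1) in
  let u := p 0 0 - a * p 0 1 ^+ 2 in
  let v := q 0 0 - a * q 0 1 ^+ 2 in
  vec2 (u + s * (v - u) + a * y ^+ 2) y.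

Lemma shear_path0 p q : shear_path p q 0 = p.
Proof. by apply: row2P; rewrite !vec2E !mul0r !addr0 ?subrK. Qed.

Lemma shear_path1 p q : shear_path p q 1 = q.
Proof. by apply: row2P; rewrite !vec2E; ring. Qed.

Lemma shear_path_continuous p q : continuous (shear_path p q).
Proof.
have lin (x y : R) : continuous (fun s : R => x + s * y).
  by move=> s; apply: cvgD; [exact: cvg_cst|apply: cvgMl; exact: cvg_id].
have sq (x y : R) : continuous (fun s : R => (x + s * y) ^+ 2).
  by under eq_fun do rewrite expr2; move=> s; apply: cvgM; exact: lin.
apply: row2_continuous; last exact: lin.
move=> s; apply: cvgD; first exact: lin.
by apply: cvgM; [exact: cvg_cst|exact: sq].
Qed.

(** Every defining function is concave along sheared segments: this is the convexity of the sheared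
    region. *)
Lemma shear_path_side l p q s : 0 <= s <= 1 ->
  (1 - s) * peval (side_eqn l) p + s * peval (side_eqn l) q <=
  peval (side_eqn l) (shear_path p q s).
Proof.
move=> /andP[s0 s1]; elim/side_indexP: l => [|k kn k0].
  rewrite !peval_side0 /shear_path !vec2E /bottom shear_bottom lerDl.
  apply: mulr_ge0; last exact: sqr_ge0.
  apply: mulr_ge0; first by rewrite subr_ge0 ltW.
  by apply: mulr_ge0 => //; rewrite subr_ge0.
by rewrite !peval_sideS // /shear_path !vec2E /arc shear_arc.
Qed.

(** A path from the closed region to a point of the open one is in the open region right after its
    start; both [closure_region] and [region_connected] rest on this. *)
Lemma shear_path_region p q s : cregion p -> region q -> 0 < s <= 1 ->
  region (shear_path p q s).
Proof.
move=> cp rq /andP[s0 s1] l.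
have s01 : 0 <= s <= 1 by rewrite ltW.
apply: (lt_le_trans _ (shear_path_side l p q s01)).
by apply: ltr_wpDl; [apply: mulr_ge0; rewrite ?subr_ge0|exact: mulr_gt0].
Qed.

Lemma region_sub : region `<=` cregion.
Proof. by move=> p rp l; exact/ltW. Qed.

Lemma region_nonempty : region !=set0.
Proof.
have k1 : (0 < 1 <= n)%N by [].
have b01 : b 0%N < b 1%N := prof_b_inc P n_gt0.
pose y := (b 0%N + b 1%N) / 2.
have [y0 y1] : b 0%N < y /\ y < b 1%N by rewrite /y; split; lra.
have yn : y < b n by apply: (lt_le_trans y1); apply: (b_le P); rewrite n_gt0 leqnn.
have by_ : bottom y < arc 1 y by apply: (bottom_lt_arc P) => //; rewrite y0.
exists (vec2 ((bottom y + arc 1 y) / 2) y); apply/regionP; rewrite !vec2E; split; first by lra.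
move=> k kk; apply: (@lt_le_trans _ _ (arc 1 y)); first by lra.
by apply: (arc_min P) => //; rewrite /= !ltW.
Qed.

Lemma closure_region : closure region = cregion.
Proof.
apply/seteqP; split=> [p|p cp].
  by move/(closure_subset region_sub); rewrite -(closure_id _).1 //; exact: cregion_closed.
have [q rq] := region_nonempty => B nB.
have : shear_path p q s @[s --> (0 : R)^'+] --> p.
  by rewrite -[X in _ --> X](shear_path0 p q); apply/cvg_at_right_filter/shear_path_continuous.
move=> /(_ _ nB) pB.
have near0 : \forall s \near (0 : R)^'+, B (shear_path p q s) /\ 0 < s <= 1.
  near=> s; split; first by near: s; exact: pB.
  apply/andP; split; first by near: s; exact: nbhs_right_gt.
  by near: s; apply: nbhs_right_le; exact: ltr01.
have [s [sB s01]] := @filter_ex _ (0 : R)^'+ _ _ near0.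
by exists (shear_path p q s); split => //; exact: shear_path_region.
Unshelve. all: by end_near. Qed.

Lemma region_connected : connected region.
Proof.
have [q rq] := region_nonempty.
have -> : region = \bigcup_(p in region) (shear_path p q @` `[0, 1]).
  apply/seteqP; split=> [p rp|_ [p rp [s /= + <-]]].
    by exists p => //; exists 0; rewrite ?shear_path0 //= in_itv /= lexx ler01.
  rewrite in_itv /= le_eqVlt => /andP[/predU1P[<- _|s0 s1]]; first by rewrite shear_path0.
  by apply: shear_path_region; rewrite ?s0 //; exact: region_sub.
apply: bigcup_connected.
  by exists q => p _; exists 1; rewrite ?shear_path1 //= in_itv /= lexx ler01.
move=> p _; apply: connected_continuous_connected; first exact: segment_connected.
exact/continuous_subspaceT/shear_path_continuous.
Qed.

Lemma cregion_compact : compact cregion.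
Proof.
apply: bounded_closed_compact; last exact: cregion_closed.
pose M := `|b 0%N| + `|b n| + (`|h 0%N| + `|arc 1 (b n)|).
have k1 : (0 < 1 <= n)%N by [].
exists M; split; first exact: num_real.
move=> m Mm p cp; apply: le_trans (ltW Mm); rewrite /Num.Def.normr /= mx_normrE.
have /andP[y0 yn] := cregion_width cp.
have /cregionP[xb xk] := cp.
have x0 : h 0%N <= p 0 0.
  by apply: le_trans xb; rewrite -(bottom0 a' b h); exact: (bottom_incr P).
have x1 : p 0 0 <= arc 1 (b n).
  apply: (le_trans (xk _ k1)); apply: (arc_incr P) => //.
  exact: le_trans (ltW (prof_lt_c1b0 P)) y0.
have M0 : 0 <= M by rewrite !addr_ge0.
apply: bigmax_le => // -[i j] _ /=; rewrite (ord1 i).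
have [->|->] := ord2_cases j; rewrite ler_norml.
  have := ler_norm (arc 1 (b n)); have := ler_norm (- h 0%N); rewrite normrN /M.
  have := normr_ge0 (b 0%N); have := normr_ge0 (b n); have := normr_ge0 (h 0%N).
  by have := normr_ge0 (arc 1 (b n)); lra.
have := ler_norm (b n); have := ler_norm (- b 0%N); rewrite normrN /M.
have := normr_ge0 (b 0%N); have := normr_ge0 (b n); have := normr_ge0 (h 0%N).
by have := normr_ge0 (arc 1 (b n)); lra.
Qed.

Definition corner i p := p 0 0 = h i /\ p 0 1 = b i.

Lemma arc_break i k : (i <= n)%N -> (0 < k <= n)%N -> h i <= arc k (b i).
Proof.
case: (posnP i) => [-> _ kk|i0 le_in kk]; first exact: (bottom_le_arc0 P).
rewrite -(prof_right P) ?i0 //; apply: (arc_min P) => //; first by rewrite i0.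
by rewrite lexx andbT; apply: (b_le P); rewrite leq_pred.
Qed.

Lemma arc_break_eq i k : (i <= n)%N -> (0 < k <= n)%N -> arc k (b i) = h i ->
  k = i \/ k = i.+1.
Proof.
move=> le_in /andP[k0 kn] e; case: (ltngtP k i) => [ki|ik|]; last by left.
  have i0 := ltn_trans k0 ki.
  have : arc i (b i) < arc k (b i).
    apply: (arc_gt P) => //; first by rewrite ki.
    by case: i i0 le_in {e ki} => // i _ le_in; exact: (prof_b_inc P).
  by rewrite e (prof_right P) ?i0 // ltxx.
move: ik; rewrite leq_eqVlt => /predU1P[|ik]; first by right.
have : arc i.+1 (b i) < arc k (b i).
  apply: (arc_lt P) => //; first by rewrite ik.
  by apply: (prof_b_inc P); apply: leq_trans kn; exact: ltnW.
by rewrite e (prof_left P) ?ltxx //; apply: leq_trans kn; exact: ltnW.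
Qed.

Lemma break_bounds i : (i <= n)%N -> b 0%N <= b i <= b n.
Proof. by move=> le_in; apply/andP; split; apply: (b_le P); rewrite ?leq0n ?le_in ?leqnn. Qed.

Lemma bottom_break i : (i <= n)%N -> bottom (b i) <= h i.
Proof.
case: (posnP i) => [-> _|i0 le_in]; first by rewrite bottom0.
have ii : (0 < i <= n)%N by rewrite i0.
by rewrite -(prof_right P ii) (bottom_le_arc P ii) // break_bounds.
Qed.

Lemma bottom_break_eq i : (i <= n)%N -> bottom (b i) = h i -> i = 0%N \/ i = n.
Proof.
case: (posnP i) => [-> _|i0]; first by left.
rewrite leq_eqVlt => /predU1P[->|lt_in]; first by right.
have ii : (0 < i <= n)%N by rewrite i0 ltnW.
have := bottom_lt_arc P (y := b i) ii; rewrite (prof_right P ii) => /[swap] ->.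
by rewrite ltxx !(b_lt P) ?i0 ?lt_in ?leqnn ?(ltnW lt_in) // => /(_ isT).
Qed.

Lemma corner_cregion i p : (i <= n)%N -> corner i p -> cregion p.
Proof.
move=> le_in [px py]; apply/cregionP; rewrite px py; split; first exact: bottom_break.
by move=> k kk; exact: arc_break.
Qed.

Lemma side0P p : side ord0 p <-> p 0 0 = bottom (p 0 1).
Proof. by []. Qed.

Lemma sideSP (l : 'I_n.+1) p : (0 < l)%N -> side l p <-> p 0 0 = arc l (p 0 1).
Proof.
rewrite lt0n => /negPf l0.
by rewrite /side /side_coef /side_mid /side_tip l0.
Qed.

Lemma slope0 y : slope ord0 y = 2 * a' * (y - b 0%N).
Proof. by []. Qed.

Lemma slopeS (l : 'I_n.+1) y : (0 < l)%N -> slope l y = 2 * a * (y - c l).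
Proof. by rewrite lt0n => /negPf l0; rewrite /slope /side_coef /side_mid l0. Qed.

(** The bottom meets the arc [1] at the corner [0] and the arc [n] at the corner [n]; at the others
    two consecutive arcs meet. The slopes differ by [c 1 < b 0], by [end_slopes] and by the growth
    of the [c i] respectively. *)
Lemma corner_active i p : (i <= n)%N -> corner i p -> exists l1 l2 : 'I_n.+1,
  [/\ l1 <> l2, forall l, side l p <-> l = l1 \/ l = l2 &
      slope l1 (p 0 1) != slope l2 (p 0 1)].
Proof.
move=> le_in [px py].
have valE (l : 'I_n.+1) k : (k <= n)%N -> (l = inord k) <-> (l = k :> nat).
  by move=> kn; split=> [->|lk]; [rewrite inordK|apply/val_inj; rewrite /= inordK].
have s0 : side ord0 p <-> i = 0%N \/ i = n.
  rewrite side0P px py; split=> [/esym/bottom_break_eq|[->|->]]; first exact.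
    by rewrite bottom0.
  by rewrite (bottomn P).
have sS (l : 'I_n.+1) : (0 < l)%N -> side l p <-> l = i :> nat \/ l = i.+1 :> nat.
  move=> l0; have ll : (0 < l <= n)%N by rewrite l0 -ltnS ltn_ord.
  rewrite sideSP // px py; split=> [/esym/arc_break_eq|]; first exact.
  case=> li; first by rewrite li (prof_right P) // -li.
  by rewrite li (prof_left P) //; case/andP: ll; rewrite li.
case: (posnP i) => [i0|i0]; last case: (ltngtP i n) le_in => // [lt_in|i_n] _.
- exists ord0, (inord 1); split.
  + by move=> /(valE _ _ n_gt0).
  + move=> l; rewrite valE //; case: (posnP l) => l0.
      have -> : l = ord0 by apply/val_inj.
      by rewrite s0 i0; split=> _; left.
    rewrite sS // i0; split=> -[]; [by lia|by right|by move=> l0'; rewrite l0' in l0|by right].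
  + rewrite slope0 slopeS ?inordK // py i0 subrr mulr0 eq_sym gt_eqF //.
    by rewrite !mulr_gt0 // subr_gt0 (prof_lt_c1b0 P).
- exists (inord i), (inord i.+1); split.
  + by move=> /(valE _ _ lt_in); rewrite inordK ?ltnS ?(ltnW lt_in) //; lia.
  + move=> l; rewrite !valE ?(ltnW lt_in) //; case: (posnP l) => l0; last exact: sS.
    by have -> : l = ord0; [apply/val_inj|rewrite s0 /=; split; lia].
  + rewrite !slopeS ?inordK ?ltnS ?(ltnW lt_in) // py gt_eqF //.
    rewrite ltr_pM2l ?mulr_gt0 // ltrD2l ltrN2; apply: (c_inc P).
    by rewrite i0.
- exists ord0, (inord n); split.
  + by move=> /(valE _ _ (leqnn n)) /= n_0; move: n_gt0; rewrite -n_0.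
  + move=> l; rewrite valE //; case: (posnP l) => l0.
      have -> : l = ord0 by apply/val_inj.
      by rewrite s0; split=> _; [left|right].
    rewrite sS // i_n; have := ltn_ord l; split=> -[] //; [by right|by lia| |by left].
    by move=> l0'; rewrite l0' in l0.
  + rewrite slope0 slopeS ?inordK // py i_n gt_eqF //.
    exact: (end_slopes P).
Qed.

(** Between the extreme corners the bottom is strictly below all arcs. If the arcs [l < l'] both
    pass through [p], then [p] is not left of [b l]; right of it the arc [l + 1] is strictly lower,
    so [p] is the corner [l]. *)
Lemma active_unique p l l' : cregion p -> (forall i, (i <= n)%N -> ~ corner i p) ->
  side l p -> side l' p -> l = l'.
Proof.
move=> cp nc; wlog ll' : l l' / (l <= l')%N => [H|sl sl'].
  by move=> sl sl'; case: (leqP l l') => [/H|/ltnW/H H']; [exact|apply/esym/H'].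
apply/val_inj/eqP; rewrite eqn_leq ll' /= leqNgt; apply/negP => lt_ll'.
have l'n : (l' <= n)%N by rewrite -ltnS.
have l'0 : (0 < l')%N by case: (val l') lt_ll'.
have /cregionP[px pk] := cp.
move/sideSP: (sl') => /(_ l'0) xl'.
case: (posnP l) => l0.
  have l00 : l = ord0 by apply/val_inj.
  move: sl; rewrite l00 side0P => xl.
  have /andP[] := cregion_width cp.
  rewrite le_eqVlt => /predU1P[y0 _|y0].
    by apply: (nc 0%N) => //; split; rewrite // xl -y0 bottom0.
  rewrite le_eqVlt => /predU1P[yn|yn].
    by apply: (nc n) => //; split; rewrite // xl yn (bottomn P).
  have := bottom_lt_arc P (k := l') (y := p 0 1).
  by rewrite -xl -xl' l'0 l'n y0 yn ltxx => /(_ isT isT).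
move/sideSP: sl => /(_ l0) xl.
have yl : b l <= p 0 1.
  rewrite leNgt; apply/negP => yl.
  have := arc_lt P l0 (j := l') (y := p 0 1).
  by rewrite -xl -xl' ltxx lt_ll' l'n => /(_ isT yl).
have ll1 : (l < n)%N := leq_trans lt_ll' l'n.
move: yl; rewrite le_eqVlt => /predU1P[yl|yl].
  apply: (nc l); first exact: ltnW.
  by split; rewrite // xl -yl (prof_right P) // l0 ltnW.
have := pk l.+1; rewrite xl ltnS ll1 leNgt => /(_ isT)/negP; apply.
by apply: (arc_gt_next P) => //; rewrite l0.
Qed.

End Region.

Lemma card_set2 (T : Type) (x y : T) : x <> y -> ([set x; y] #= `I_2)%card.
Proof.
move=> xy; apply/eq_cardSP; exists x; first by left.
rewrite (_ : _ `\ x = [set y]); first exact: card_set1.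
apply/seteqP; split=> z /=; first by case=> -[|->].
by move=> ->; split; [right|move=> yx; apply: xy].
Qed.

Lemma has_dim_ext (R : realType) n (T T' : set 'rV[R]_n.+1) d :
  has_dim T d -> (forall v, T v <-> T' v) -> has_dim T' d.
Proof. by move=> [W [dW WT]] TT'; exists W; split=> // v; rewrite WT. Qed.

(** * The RA-region and its singular points *)

Section RealAlgebraicRegion.
Variables (R : realType) (a a' : R) (n : nat) (b c t h : nat -> R).
Hypothesis P : profile a a' n b c t h.
Implicit Types p q : 'rV[R]_2.

Local Notation arc := (arc a c t).
Local Notation bottom := (bottom a' b h).
Local Notation side := (@side R a a' n b c t h).
Local Notation slope := (@slope R a a' n b c).
Local Notation eqn := (@side_eqn R a a' n b c t h).
Local Notation region := (@region R a a' n b c t h).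
Local Notation cregion := (@cregion R a a' n b c t h).
Local Notation corner := (corner b h).

Let n_gt0 := prof_n_gt0 P.

Lemma between_breaks k y i : (0 < k <= n)%N -> b k.-1 < y < b k -> (i <= n)%N -> y <> b i.
Proof.
move=> /andP[k0 kn] /andP[y0 y1] le_in yb.
case: (ltnP i k) => [ik|ki].
  have /(b_le P) : (i <= k.-1 <= n)%N by rewrite -ltnS prednK // ik (leq_trans (leq_pred k)).
  by rewrite -yb leNgt y0.
have /(b_le P) : (k <= i <= n)%N by rewrite ki.
by rewrite -yb leNgt y1.
Qed.

Lemma side_own_point l : exists2 p, cregion p & forall l', side l' p <-> l' = l.
Proof.
have mid k (y := (b k.-1 + b k) / 2) : (0 < k <= n)%N -> b k.-1 < y < b k.
  move=> /andP[k0 kn]; have : b k.-1 < b k.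
    by case: k k0 kn {y} => // k _ kn; exact: (prof_b_inc P).
  by rewrite /y => ?; apply/andP; split; lra.
suff [p [cp nc lp]] : exists p,
    [/\ cregion p, (forall i, (i <= n)%N -> ~ corner i p) & side l p].
  by exists p => // l'; split=> [l'p|->//]; exact: (active_unique P cp nc l'p lp).
case: (posnP l) => l0.
  have kk : (0 < 1 <= n)%N by [].
  have yy := mid 1%N kk; set y := _ / _ in yy.
  have /andP[y0 y1] := yy.
  exists (vec2 (bottom y) y); split.
  - apply/cregionP; rewrite !vec2E; split=> // k kk'.
    apply: (bottom_le_arc P) => //; rewrite (ltW y0) /=; apply: (le_trans (ltW y1)).
    by apply: (b_le P); rewrite n_gt0 leqnn.
  - by move=> i le_in [_]; rewrite vec2E; exact: (between_breaks kk yy).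
  - have -> : l = ord0 by apply/val_inj.
    by rewrite side0P !vec2E.
have kk : (0 < l <= n)%N by rewrite l0 -ltnS ltn_ord.
have yy := mid _ kk; set y := _ / _ in yy.
have /andP[y0 y1] := yy.
exists (vec2 (arc l y) y); split.
- apply/cregionP; rewrite !vec2E; split.
    apply: (bottom_le_arc P) => //; apply/andP; split.
      apply: (le_trans _ (ltW y0)); apply: (b_le P).
      by rewrite leq0n (leq_trans (leq_pred l)) //; case/andP: kk.
    apply: (le_trans (ltW y1)); apply: (b_le P).
    by rewrite leqnn andbT; case/andP: kk.
  by move=> k kk'; apply: (arc_min P) => //; rewrite (ltW y0) (ltW y1).
- by move=> i le_in [_]; rewrite vec2E; exact: (between_breaks kk yy).
- by rewrite sideSP // !vec2E.
Qed.

(** Needed because [manifolds_through] counts sets, not indices. *)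
Lemma side_inj : injective side.
Proof.
move=> l l' ll'; have [p _ pP] := side_own_point l.
by apply/esym/pP; rewrite -ll'; apply/pP.
Qed.

Lemma active_cases p : cregion p ->
  [\/ exists2 i, (i <= n)%N & corner i p,
      (forall i, (i <= n)%N -> ~ corner i p) /\ forall l, ~ side l p |
      (forall i, (i <= n)%N -> ~ corner i p) /\
        exists l, forall l', side l' p <-> l' = l].
Proof.
move=> cp; case: (pselect (exists2 i, (i <= n)%N & corner i p)) => [|nc]; first by constructor 1.
have {}nc i : (i <= n)%N -> ~ corner i p by move=> le_in ci; apply: nc; exists i.
case: (pselect (exists l, side l p)) => [[l lp]|nl]; last first.
  by constructor 2; split=> // l lp; apply: nl; exists l.
constructor 3; split=> //; exists l => l'; split=> [l'p|->//].
exact: (active_unique P cp nc l'p lp).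
Qed.

Lemma manifolds_corner i p : (i <= n)%N -> corner i p ->
  (manifolds_through side p #= `I_2)%card.
Proof.
move=> le_in ci; have [l1 [l2 [l12 act _]]] := corner_active P le_in ci.
rewrite (_ : manifolds_through side p = [set side l1; side l2]).
  by apply: card_set2 => /side_inj.
apply/seteqP; split=> [_ [l /act[->|->] <-]|_ [->|->]]; [by left|by right| |].
  by exists l1 => //; apply/act; left.
by exists l2 => //; apply/act; right.
Qed.

Lemma manifolds_none p : (forall l, ~ side l p) -> (manifolds_through side p #= `I_0)%card.
Proof.
move=> nl; rewrite (_ : manifolds_through side p = set0) ?II0 //.
by apply/seteqP; split=> // x [l /nl].
Qed.

Lemma manifolds_one l p : (forall l', side l' p <-> l' = l) ->
  (manifolds_through side p #= `I_1)%card.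
Proof.
move=> lP; rewrite (_ : manifolds_through side p = [set side l]); first exact: card_set1.
apply/seteqP; split=> [_ [l' /lP -> <-]//|_ ->].
by exists l => //; apply/lP.
Qed.

Lemma manifolds_card p k m : (manifolds_through side p #= `I_k)%card ->
  (manifolds_through side p #= `I_m)%card -> k = m.
Proof.
by move=> pk pm; apply/card_eq_II; rewrite -(card_eql pk).
Qed.

Lemma tangent_side l p v : side l p ->
  tangent_space (side l) p v <-> v 0 0 = slope l (p 0 1) * v 0 1.
Proof. exact: tangent_side_parabola. Qed.

(** Strict inequalities at [p] persist nearby, and the equations holding at [p] are kept by [u]. *)
Lemma near_stratum p (u : R -> 'rV[R]_2) : cregion p -> continuous u -> u 0 = p ->
  (forall l, side l p -> forall s, side l (u s)) ->
  \forall s \near (0 : R), stratum region side p (u s).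
Proof.
move=> cp cu u0 up.
have near0 : \forall s \near (0 : R), forall l, ~ side l p -> 0 < peval (eqn l) (u s).
  apply: (filter_forall (nbhs_filter (0 : R))) => l; case: (pselect (side l p)) => [lp|nlp].
    by near=> s.
  have pl : 0 < peval (eqn l) p.
    by rewrite lt_neqAle cp andbT eq_sym; apply/eqP => e0; apply/nlp/sideP.
  have cu0 : u s @[s --> (0 : R)] --> p by rewrite -u0; exact: cu.
  have nu : nbhs (0 : R) [set s | 0 < peval (eqn l) (u s)] by exact: (cu0 _ (side_near_pos pl)).
  by near=> s => _; near: s.
near=> s; have us : forall l, ~ side l p -> 0 < peval (eqn l) (u s) by near: s.
split.
  rewrite (closure_region P) => l; case: (pselect (side l p)) => [lp|/us/ltW//].
  by move/up: lp => /(_ s) /sideP ->.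
move=> l; split=> [us0|/up//]; apply: contrapT => /us.
by move/sideP: us0 => ->; rewrite ltxx.
Unshelve. all: by end_near. Qed.

Lemma affine_continuous (y w : R) : continuous (fun s : R => y + s * w).
Proof. by move=> s; apply: cvgD; [exact: cvg_cst|apply: cvgMl; exact: cvg_id]. Qed.

(** Away from the corners, an interior point has the tangent vector [(1, 0)] and a point on a single
    curve has [(slope, 1)], so a singular point is the vertex of its parabola. The vertex of the
    bottom is the corner [0]. *)
Lemma singular_cases p : singular_point region side p ->
  closure region p /\ ((exists2 i, (i <= n)%N & corner i p) \/
  exists2 k, (0 < k <= n)%N & p 0 0 = arc k (p 0 1) /\ p 0 1 = c k).
Proof.
move=> [cp sp]; split=> //; have cp' := cp; rewrite (closure_region P) in cp'.
have [?|[nc nl]|[nc [l lP]]] := active_cases cp'; first by left.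
  case: sp => [[k k2 [_ crit]]|]; last by move/(manifolds_card (manifolds_none nl)).
  have : tangent_space (stratum region side p) p (vec2 1 0).
    apply: straight_curve_tangent; apply: near_stratum => //.
    - by apply: row2_continuous; exact: affine_continuous.
    - by apply: row2P; rewrite vec2E mul0r addr0.
    - by move=> l /nl.
  by move/crit; rewrite vec2E => /eqP; rewrite oner_eq0.
case: sp => [[k k2 [_ crit]]|]; last by move/(manifolds_card (manifolds_one lP)).
have lp : side l p by apply/lP.
have sl0 : slope l (p 0 1) = 0.
  have : tangent_space (stratum region side p) p (vec2 (slope l (p 0 1)) 1).
    apply: (side_curve_tangent lp); first by rewrite !vec2E mulr1.
    rewrite vec2E; apply: near_stratum => //.
    - apply: row2_continuous; last exact: affine_continuous.
      have sq : continuous (fun s : R => (p 0 1 + s * 1 - side_mid b c l) *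
                                        (p 0 1 + s * 1 - side_mid b c l)).
        by move=> s; apply: cvgM; apply: cvgB; (try exact: cvg_cst); exact: affine_continuous.
      under eq_fun do rewrite expr2.
      move=> s; apply: cvgD; last exact: cvg_cst.
      by apply: cvgM; [exact: cvg_cst|exact: sq].
    - by apply: row2P; rewrite vec2E mul0r addr0 //; exact/esym.
    - by move=> l' /lP -> s; exact: side_curve_in.
  by move/crit; rewrite vec2E.
have [a0 a'0] : a != 0 /\ a' != 0.
  have a0 := prof_a_gt0 P; have aa' := prof_lt_a P.
  by rewrite !gt_eqF // (lt_trans a0).
case: (posnP l) => l0.
  have l00 : l = ord0 by apply/val_inj.
  move: sl0 lp; rewrite l00 slope0 side0P => /eqP.
  rewrite !mulf_eq0 pnatr_eq0 (negPf a'0) /= subr_eq0 => /eqP y0 x0.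
  by case: (nc 0%N) => //; split; rewrite // x0 y0 bottom0.
right; exists l; first by rewrite l0 -ltnS ltn_ord.
move: sl0 lp; rewrite slopeS // sideSP // => /eqP.
by rewrite !mulf_eq0 pnatr_eq0 (negPf a0) /= subr_eq0 => /eqP ? ->.
Qed.

Lemma corner_singular i p : (i <= n)%N -> corner i p -> singular_point region side p.
Proof.
move=> le_in ci; split; last by right; exact: manifolds_corner ci.
by rewrite (closure_region P); exact: (corner_cregion P le_in ci).
Qed.

(** The whole plane serves as the neighbourhood in the definition of RA-regions; it is covered by
    sheared segments ending at the origin. *)
Lemma plane_connected : connected [set: 'rV[R]_2].
Proof.
have -> : [set: 'rV[R]_2] = \bigcup_(p in setT) (shear_path a p 0 @` `[0, 1]).
  apply/seteqP; split=> // p _; exists p => //.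
  by exists 0; rewrite ?shear_path0 //= in_itv /= lexx ler01.
apply: bigcup_connected.
  by exists 0 => p _; exists 1; rewrite ?shear_path1 //= in_itv /= lexx ler01.
move=> p _; apply: connected_continuous_connected; first exact: segment_connected.
exact/continuous_subspaceT/shear_path_continuous.
Qed.

Lemma region_transversality p k : closure region p -> (1 <= k <= 2)%N ->
  (manifolds_through side p #= `I_k)%card ->
  has_dim (\bigcap_(l in [set l | side l p]) tangent_space (side l) p) (2 - k).
Proof.
rewrite (closure_region P) => cp /andP[k1 _] kc.
have [[i le_in ci]|[_ nl]|[_ [l lP]]] := active_cases cp.
- rewrite -(manifolds_card (manifolds_corner le_in ci) kc).
  have [l1 [l2 [_ act sl]]] := corner_active P le_in ci.
  have l1p : side l1 p by apply/act; left.
  have l2p : side l2 p by apply/act; right.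
  apply: (has_dim_ext (two_lines_has_dim sl)) => v.
  split=> [[v1 v2] l /act[]->|tv]; last by split; apply/tangent_side => //; apply: tv.
  + exact/tangent_side.
  + exact/tangent_side.
- by move: k1; rewrite -(manifolds_card (manifolds_none nl) kc).
- rewrite -(manifolds_card (manifolds_one lP) kc).
  have lp : side l p by apply/lP.
  apply: (has_dim_ext (line_has_dim (slope l (p 0 1)))) => v.
  split=> [v1 l' /lP ->|tv]; first exact/tangent_side.
  by apply/tangent_side => //; apply: tv.
Qed.

Lemma region_is_RA_region : is_RA_region region side eqn.
Proof.
split.
- exact: (region_nonempty P).
- exact: (region_connected P).
- exact: region_open.
- by move=> l; apply: side_parabola_hypersurface; exact: side_sign_neq0.
- move=> l; have [p cp pP] := side_own_point l.
  by exists p; rewrite (closure_region P); split=> //; apply/pP.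
- exists setT; split=> //; first exact: openT.
  + exact: plane_connected.
  + by rewrite setTI; apply/seteqP; split=> [p rp l _|p rp l]; [exact: rp|exact: (rp l I)].
  + by move=> l; rewrite !setTI; apply/seteqP; split=> p /sideP.
- move=> p; rewrite (closure_region P).
  move=> /active_cases[[i le_in ci]|[_ nl]|[_ [l lP]]].
  + by rewrite (card_le_eql (manifolds_corner le_in ci)) card_le_II.
  + by rewrite (card_le_eql (manifolds_none nl)) card_le_II.
  + by rewrite (card_le_eql (manifolds_one lP)) card_le_II.
- exact: region_transversality.
Qed.

End RealAlgebraicRegion.

(** * The Reeb space of the region *)

Section ReebMap.
Variables (R : realType) (a a' : R) (n : nat) (b c t h : nat -> R).
Hypothesis P : profile a a' n b c t h.
Variable pa : nat -> nat.
Hypotheses (pa_lt : forall i, (0 < i <= n)%N -> (pa i < i)%N)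
  (t_pa : forall i, (1 < i <= n)%N -> t i = h (pa i)).
Implicit Types p q : 'rV[R]_2.

Local Notation arc := (arc a c t).
Local Notation bottom := (bottom a' b h).
Local Notation side := (@side R a a' n b c t h).
Local Notation region := (@region R a a' n b c t h).
Local Notation cregion := (@cregion R a a' n b c t h).
Local Notation corner := (corner b h).

Let n_gt0 := prof_n_gt0 P.

(* The part of the region over [[cut i, cut i.+1]] lies around the [i]-th
   corner and is mapped to the path from the root to the [i]-th vertex. *)
Definition cut i := if (i <= 1)%N then b 0%N else if (i <= n)%N then c i else b n.

Definition over i p := cut i <= p 0 1 <= cut i.+1.

Lemma cut_le_b i : (i <= n)%N -> cut i <= b i.
Proof.
move=> le_in; rewrite /cut le_in; case: leqP => [_|i1]; first by apply: (b_le P).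
by apply/ltW/(prof_lt_cb P); rewrite (ltnW i1).
Qed.

Lemma b_le_cut i : (i <= n)%N -> b i <= cut i.+1.
Proof.
move=> le_in; rewrite /cut; case: (posnP i) => [->//|i0].
rewrite ltnS leqNgt i0 /=.
case: (ltnP i n) => [lt_in|_]; first by apply: (prof_le_bc P); rewrite i0.
by apply: (b_le P); rewrite le_in leqnn.
Qed.

Lemma cut_leS i : (i <= n)%N -> cut i <= cut i.+1.
Proof. by move=> le_in; apply: le_trans (cut_le_b le_in) (b_le_cut le_in). Qed.

Lemma cut_le i j : (i <= j <= n.+1)%N -> cut i <= cut j.
Proof.
move=> /andP[]; elim: j => [|j IH]; first by rewrite leqn0 => /eqP ->.
rewrite leq_eqVlt => /predU1P[->//|]; rewrite !ltnS => ij jn.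
exact: le_trans (IH ij (leqW jn)) (cut_leS jn).
Qed.

Lemma cut0 : cut 0 = b 0%N. Proof. by []. Qed.

Lemma cut_last : cut n.+1 = b n.
Proof. by rewrite /cut ltnS leqNgt n_gt0 /= ltnn. Qed.

Lemma c_le_cut i : (0 < i <= n)%N -> c i <= cut i.
Proof.
move=> /andP[i0 le_in]; rewrite /cut le_in; case: leqP => // i1.
have -> : i = 1%N by lia.
exact: ltW (prof_lt_c1b0 P).
Qed.

(** For [i > 1] this is the vertex of the arc; for [i = 1] it is the root corner, and [pa 1 = 0]. *)
Lemma arc_cut i : (0 < i <= n)%N -> arc i (cut i) = h (pa i).
Proof.
move=> /andP[i0 le_in]; rewrite /cut le_in; case: leqP => [i1|i1].
  have i_1 : i = 1%N by lia.
  have := pa_lt (i := i); rewrite i0 le_in i_1 => /(_ isT); rewrite ltnS leqn0 => /eqP ->.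
  exact: (prof_left P).
by rewrite /arc subrr expr0n mulr0 add0r t_pa // i1.
Qed.

Lemma over_exists p : cregion p -> exists2 i, (i <= n)%N & over i p.
Proof.
move/(cregion_width P) => /andP[y0 yn].
suff H m : (m <= n)%N -> p 0 1 <= cut m.+1 -> exists2 i, (i <= m)%N & over i p.
  by apply: H => //; rewrite cut_last.
elim: m => [|m IH] mn ym; first by exists 0%N => //; rewrite /over cut0 y0.
case: (leP (cut m.+1) (p 0 1)) => [my|/ltW ym'].
  by exists m.+1 => //; rewrite /over my.
by have [i im oi] := IH (ltnW mn) ym'; exists i; rewrite // leqW.
Qed.

Lemma over_cut i j p : (i < j <= n)%N -> over i p -> over j p ->
  forall l, (i < l <= j)%N -> p 0 1 = cut l.
Proof.
move=> /andP[ij jn] /andP[_ pi_] /andP[pj _] l /andP[il lj].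
have /cut_le le1 : (i.+1 <= l <= n.+1)%N by rewrite il leqW // (leq_trans lj).
have /cut_le le2 : (l <= j <= n.+1)%N by rewrite lj leqW.
by apply/le_anti; rewrite (le_trans pi_ le1) (le_trans le2 pj).
Qed.

(** The line [y = cut l] can only be crossed below the height of the parent of [l]; this separates
    the components of level sets. *)
Lemma cregion_cut p l : cregion p -> (0 < l <= n)%N -> p 0 1 = cut l -> p 0 0 <= h (pa l).
Proof. by move=> /cregionP[_ pk] ll pl; rewrite -(arc_cut ll) -pl; exact: pk. Qed.

(** Over the strip [i] the upper boundary climbs to the corner [i] and descends after it. *)
Lemma over_height i p : (i <= n)%N -> cregion p -> over i p -> h 0%N <= p 0 0 <= h i.
Proof.
move=> le_in cp /andP[ip pi_]; have /andP[y0 yn] := cregion_width P cp.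
have /cregionP[xb xk] := cp.
apply/andP; split.
  by apply: le_trans xb; rewrite -(bottom0 a' b h); exact: (bottom_incr P).
case: (leP (p 0 1) (b i)) => [yb|by_].
  case: (posnP i) => [i0|i0].
    have yE : p 0 1 = b 0%N by apply/le_anti; move: yb; rewrite i0 y0 => ->.
    by rewrite i0 -(prof_left P n_gt0) -yE; exact: xk.
  have ii : (0 < i <= n)%N by rewrite i0.
  apply: (le_trans (xk _ ii)); rewrite -(prof_right P ii); apply: (arc_incr P) => //.
  exact: le_trans (c_le_cut ii) ip.
have lt_in : (i < n)%N.
  rewrite ltn_neqAle le_in andbT; apply/eqP => i_n.
  by move: by_; rewrite i_n ltNge yn.
have i0 : (0 < i)%N.
  case: (posnP i) => // i0; move: by_ pi_; rewrite i0 /cut /= => by_.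
  by rewrite leNgt => /negP.
apply: (le_trans (xk i.+1 _)); first by rewrite ltnS lt_in.
rewrite -(prof_left P lt_in); apply: (arc_decr P); last exact: ltW.
by move: pi_; rewrite /cut ltnS leqNgt i0 lt_in.
Qed.

(** Since the bottom increases, its value at [q] decides. Above, let [k] be the arc over [y]. If
    [k = i], it ascends from [p]; if [i < k <= j], it stays above its vertex height [h (pa k)]; if
    [j < k], it descends towards [c k], so is at least as high at [y] as at [q]; if [k < i], then
    [y] is the coordinate of [p]. The first arc is treated apart, its vertex being left of [b 0]. *)
Lemma vertical_segment i j p q y : (i <= j <= n)%N -> cregion p -> cregion q ->
  over i p -> over j q -> p 0 0 = q 0 0 ->
  (forall l, (i < l <= j)%N -> p 0 0 <= h (pa l)) ->
  p 0 1 <= y <= q 0 1 -> cregion (vec2 (p 0 0) y).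
Proof.
move=> /andP[ij jn] cp cq /andP[ip _] /andP[_ qj] pq xl /andP[py yq].
have /andP[p0 _] := cregion_width P cp; have /andP[_ qn] := cregion_width P cq.
have /cregionP[pb pk] := cp; have /cregionP[qb qk] := cq.
apply/cregionP; rewrite !vec2E; split.
  by rewrite pq; apply: le_trans qb; apply: (bottom_incr P) => //; exact: le_trans p0 py.
suff [k kk [ky xk]] : exists2 k, (0 < k <= n)%N & b k.-1 <= y <= b k /\ p 0 0 <= arc k y.
  by move=> k' kk'; apply: (le_trans xk); exact: (arc_min P).
have [k kk ky] : exists2 k, (0 < k <= n)%N & b k.-1 <= y <= b k.
  by apply: (breakpoint_locate P); rewrite (le_trans p0 py) (le_trans yq qn).
exists k => //; split=> //; have /andP[yk1 yk2] := ky; have /andP[k0 kn] := kk.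
have kn1 : (k.-1 <= n)%N := leq_trans (leq_pred k) kn.
have cutk : (i < k <= j)%N -> p 0 0 <= arc k (cut k) by move/xl; rewrite (arc_cut kk).
have tk : (1 < k)%N -> (i < k <= j)%N -> p 0 0 <= arc k y.
  move=> k1 ikj; apply: (le_trans (xl _ ikj)); rewrite -t_pa ?k1 //.
  exact: (arc_ge_vertex P).
case: (ltngtP i k) => ik; last first.
- apply: (le_trans (pk _ kk)); apply: (arc_incr P) => //.
  by apply: (le_trans (c_le_cut kk)); rewrite -ik.
- have yE : y = p 0 1.
    apply/le_anti; rewrite py andbT (le_trans yk2) // (le_trans _ ip) //.
    apply: (le_trans (b_le_cut kn)); apply: cut_le.
    by rewrite ik leqW // (leq_trans ij).
  by rewrite yE; exact: pk.
case: (leqP k j) => kj.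
  case: (ltnP 1 k) => k1; first by apply: tk => //; rewrite ik.
  have k_1 : k = 1%N by apply/eqP; rewrite eqn_leq k1.
  apply: (le_trans (cutk _)); first by rewrite ik.
  by apply: (arc_incr P); rewrite ?(c_le_cut kk) // k_1 /cut (le_trans p0 py).
have qk1 : q 0 1 <= cut k.
  by apply: (le_trans qj); apply: cut_le; rewrite kj leqW.
rewrite pq; case: (ltnP 1 k) => k1; last first.
  have k_1 : k = 1%N by apply/eqP; rewrite eqn_leq k1.
  have -> : y = q 0 1.
    apply/le_anti; rewrite yq /=; apply: (le_trans qk1).
    by rewrite k_1 /cut (le_trans p0 py).
  exact: qk.
apply: (le_trans (qk _ kk)); apply: (arc_decr P) => //.
by move: qk1; rewrite /cut leqNgt k1 kn.
Qed.

(** * The map from the closed region to the tree *)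

Section Branches.
Variables (X : topologicalType) (br : nat -> R -> X).
Hypotheses (br_cont : forall i, (i <= n)%N -> continuous (br i))
  (br_eq : forall i j x y, (i <= j <= n)%N -> h 0%N <= x <= h i -> h 0%N <= y <= h j ->
     br i x = br j y <-> x = y /\ forall l, (i < l <= j)%N -> x <= h (pa l))
  (br_surj : forall z, exists i x, [/\ (i <= n)%N, h 0%N <= x <= h i & br i x = z]).

Local Notation T := (closure region).

Let inT (p : T) : cregion (set_val p).
Proof. by rewrite -(closure_region P); exact: set_valP. Qed.

Let mkT p (cp : cregion p) : T :=
  exist _ p (mem_set (eq_ind_r (fun A : set 'rV[R]_2 => A p) cp (closure_region P))).

(** A point in two strips lies on every cut between them, hence at heights where [cregion_cut] makes
    the two paths agree. *)
Lemma reeb_map_exists : exists F : T -> X, forall (p : T) i, (i <= n)%N ->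
  over i (set_val p) -> F p = br i (set_val p 0 0).
Proof.
suff /choice[F FP] : forall p : T, exists z, forall i, (i <= n)%N ->
    over i (set_val p) -> z = br i (set_val p 0 0).
  by exists F => p i; exact: FP.
move=> p; have cp := inT p; have [i le_in oi] := over_exists cp.
exists (br i (set_val p 0 0)) => j le_jn oj.
wlog ij : i j le_in oi le_jn oj / (i <= j)%N => [H|].
  by case: (leqP i j) => [/H|/ltnW/H H']; [exact|apply/esym/H'].
apply/br_eq; rewrite ?ij //; try exact: over_height.
split=> // l /andP[il lj]; apply: (cregion_cut cp).
  by rewrite (leq_trans _ il) // (leq_trans lj).
by apply: (over_cut (i := i) (j := j)); rewrite ?il ?lj ?le_jn ?(leq_trans il lj).
Qed.

Section Map.
Variable F : T -> X.
Hypothesis FP : forall (p : T) i, (i <= n)%N -> over i (set_val p) -> F p = br i (set_val p 0 0).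

Lemma reeb_map_continuous : continuous F.
Proof.
apply/continuous_closedP => A cA.
pose y_ (p : T) := (set_val p : 'rV[R]_2) 0 1.
pose x_ (p : T) := (set_val p : 'rV[R]_2) 0 0.
have sv : continuous (set_val : T -> 'rV[R]_2) by exact: initial_continuous.
have c0 : continuous (fun q : 'rV[R]_2 => q 0 0) by exact: coord_continuous.
have c1 : continuous (fun q : 'rV[R]_2 => q 0 1) by exact: coord_continuous.
have cy : continuous y_ by move=> w; exact: (continuous_comp (sv w) (c1 _)).
have cx : continuous x_ by move=> w; exact: (continuous_comp (sv w) (c0 _)).
have -> : F @^-1` A = \bigcup_(i in `I_n.+1)
    ((y_ @^-1` [set y | cut i <= y] `&` y_ @^-1` [set y | y <= cut i.+1]) `&`
     x_ @^-1` (br i @^-1` A)).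
  apply/seteqP; split=> [p /= Fp|p [i /= le_in [[y1 y2]]]].
    have [i le_in oi] := over_exists (inT p).
    exists i => //; split; first by move: oi => /andP[].
    by rewrite /= -(FP le_in oi).
  by rewrite -(FP (i := i)) //; apply/andP.
apply: closed_bigcup; first exact: finite_II.
move=> i /= le_in; apply: closedI.
  by apply: closedI; move/continuous_closedP: cy; apply; [exact: closed_ge|exact: closed_le].
move/continuous_closedP: cx; apply.
by have /continuous_closedP := br_cont (i := i) le_in; apply.
Qed.

Lemma reeb_map_corner i (p : T) : (i <= n)%N -> corner i (set_val p) -> F p = br i (h i).
Proof.
move=> le_in [px py]; rewrite (FP (i := i)) ?px //.
by rewrite /over py cut_le_b // b_le_cut.
Qed.

(** The bottom of a descent goes to the parent. The case [k = 1] cannot occur, as [c 1 < b 0] puts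
    that vertex outside the region. *)
Lemma reeb_map_vertex k (p : T) : (0 < k <= n)%N ->
  set_val p 0 0 = arc k (set_val p 0 1) -> set_val p 0 1 = c k ->
  F p = br k (h (pa k)).
Proof.
move=> kk px py; have /andP[k0 kn] := kk.
have /andP[y0 yn] := cregion_width P (inT p).
have k1 : (1 < k)%N.
  rewrite ltnNge; apply/negP => k1; have k_1 : k = 1%N by apply/eqP; rewrite eqn_leq k1.
  by move: y0; rewrite py k_1 leNgt (prof_lt_c1b0 P).
rewrite (FP (i := k)) //; first by rewrite px py -(arc_cut kk) /cut leqNgt k1 kn.
rewrite /over py {1}/cut leqNgt k1 kn lexx /=.
by apply: le_trans (b_le_cut kn); apply/ltW/(prof_lt_cb P).
Qed.

(** If [x] is at least the bottom height at [b i], the point is taken on the line [y = b i].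
    Otherwise it is taken on the bottom curve, in a strip [j <= i]; at a cut [l] between, [x <=
    bottom (cut l) <= arc l (cut l) = h (pa l)], so the paths to [j] and [i] agree at [x]. *)
Lemma reeb_map_surj z : exists p : T, F p = z.
Proof.
have [i [x [le_in /andP[x0 xi] <-]]] := br_surj z.
case: (leP (bottom (b i)) x) => [bx|xb].
  have cp : cregion (vec2 x (b i)).
    apply/cregionP; rewrite !vec2E; split=> // k kk.
    exact: le_trans xi (arc_break P le_in kk).
  exists (mkT cp); rewrite (FP (i := i)) //= ?vec2E //.
  by rewrite /over vec2E cut_le_b // b_le_cut.
have a'0 : 0 < a' := lt_trans (prof_a_gt0 P) (prof_lt_a P).
(* The inverse of the increasing branch of [bottom], at [x]. *)
pose y := b 0%N + Num.sqrt ((x - h 0%N) / a').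
have y0 : b 0%N <= y by rewrite lerDl sqrtr_ge0.
have yx : bottom y = x.
  rewrite /bottom /y [b 0%N + _]addrC addrK sqr_sqrtr; last by rewrite divr_ge0 ?subr_ge0 // ltW.
  by rewrite mulrC divfK ?gt_eqF // subrK.
have yi : y < b i.
  rewrite ltNge; apply/negP => iy; move: xb; rewrite -yx ltNge => /negP; apply.
  by apply: (bottom_incr P) => //; have /andP[] := break_bounds P le_in.
have yn : y <= b n by apply: (le_trans (ltW yi)); have /andP[] := break_bounds P le_in.
have cp : cregion (vec2 x y).
  apply/cregionP; rewrite !vec2E yx; split=> // k kk.
  by rewrite -yx; apply: (bottom_le_arc P) => //; rewrite y0.
have [j le_jn oj] := over_exists cp.
exists (mkT cp); rewrite (FP (i := j)) //= vec2E.
have ji : (j <= i)%N.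
  rewrite leqNgt; apply/negP => ij; move: oj => /andP[]; rewrite vec2E leNgt => /negP; case.
  apply: (lt_le_trans yi); apply: (le_trans (b_le_cut le_in)); apply: cut_le.
  by rewrite ij leqW.
apply/br_eq; rewrite ?ji //; first by have := over_height le_jn cp oj; rewrite vec2E.
  by rewrite x0.
split=> // l /andP[jl li].
have ll : (0 < l <= n)%N by rewrite (leq_trans _ jl) // (leq_trans li).
have yl : y <= cut l.
  move: oj => /andP[_]; rewrite vec2E => /le_trans; apply; apply: cut_le.
  by rewrite jl leqW //; case/andP: ll.
rewrite -yx -(arc_cut ll); apply: (le_trans (bottom_incr P y0 yl)).
apply: (bottom_le_arc P) => //; rewrite (le_trans y0 yl) /=.
apply: (le_trans (cut_le_b _)); first by case/andP: ll.
by apply: (b_le P); rewrite leqnn andbT; case/andP: ll.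
Qed.

Local Notation proj := (@proj1_closure R 1 region).

Lemma vertical_connected (p q : T) : set_val p 0 0 = set_val q 0 0 ->
  set_val p 0 1 <= set_val q 0 1 ->
  (forall y, set_val p 0 1 <= y <= set_val q 0 1 -> cregion (vec2 (set_val p 0 0) y)) ->
  reeb_rel proj p q.
Proof.
move=> px py seg; set x := set_val p 0 0 in seg px *.
set y0 := set_val p 0 1 in seg py *; set y1 := set_val q 0 1 in seg py *.
pose clip (s : R) := Num.max y0 (Num.min y1 s).
have clipE s : y0 <= s <= y1 -> clip s = s.
  by move=> /andP[s0 s1]; rewrite /clip min_r // max_r.
have clip_in s : y0 <= clip s <= y1.
  by rewrite /clip le_max lexx /= ge_max py /= ge_min lexx.
have clip_cont : continuous clip.
  move=> s; apply: continuous_max; first exact: cvg_cst.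
  by apply: continuous_min; [exact: cvg_cst|exact: cvg_id].
pose u s : T := mkT (seg _ (clip_in s)).
have u_cont : continuous u.
  apply: (@continuous_comp_initial _ _ _ (set_val : T -> 'rV[R]_2)).
  apply: (@row2_continuous R R (fun=> x) clip) => // s; exact: cvg_cst.
have uE (w : T) s : set_val w 0 0 = x -> set_val w 0 1 = s -> y0 <= s <= y1 -> u s = w.
  move=> wx wy s01; apply/val_inj/row2P; rewrite /= vec2E //.
  by rewrite clipE.
apply/asboolP; exists x; exists (u @` `[y0, y1]); last first.
  by exists y1; rewrite /= ?in_itv /= ?py ?lexx //; apply: uE => //; rewrite py lexx.
split.
- by exists y0; rewrite /= ?in_itv /= ?py ?lexx //; apply: uE => //; rewrite py lexx.
- by move=> _ [s _ <-]; rewrite /proj1_closure /= vec2E.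
- apply: connected_continuous_connected; first exact: segment_connected.
  exact/continuous_subspaceT.
Qed.

(** Equal images are joined by a vertical segment. Conversely, a connected part of a level set
    projects to an interval, so it crosses every [cut l] between the two strips, where heights are
    at most [h (pa l)]. *)
Lemma reeb_map_fiber (p q : T) : F p = F q <-> reeb_rel proj p q.
Proof.
have [i le_in oi] := over_exists (inT p); have [j le_jn oj] := over_exists (inT q).
wlog ij : p q i j le_in le_jn oi oj / (i <= j)%N => [H|].
  case: (leqP i j) => [/H|/ltnW/H H']; first exact.
  by rewrite reeb_rel_sym -H' //; split=> /esym.
have /(br_eq (i := i) (j := j)) brE : (i <= j <= n)%N by rewrite ij.
have {brE} := brE _ _ (over_height le_in (inT p) oi) (over_height le_jn (inT q) oj).
rewrite -(FP le_in oi) -(FP le_jn oj) => FE; split=> [/FE[px pl]|/asboolP[r [B [Bp Br Bc] Bq]]].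
  (* The strips are ordered, so [q] strictly before [p] forces [i = j]. *)
  case: (leP (set_val p 0 1) (set_val q 0 1)) => [pq|qp].
    apply: vertical_connected => // y; apply: (vertical_segment (i := i) (j := j)) => //.
    by rewrite ij.
  have ji : j = i.
    apply/eqP; rewrite eqn_leq ij andbT leqNgt; apply/negP => lt_ij.
    move: qp; rewrite ltNge => /negP; apply.
    move: oi oj => /andP[_ p1] /andP[q0 _]; apply: (le_trans p1); apply: le_trans q0.
    by apply: cut_le; rewrite lt_ij leqW.
  subst j; rewrite reeb_rel_sym; apply: vertical_connected => //; first exact: ltW.
  move=> y; apply: (vertical_segment (i := i) (j := i)) => //; first by rewrite leqnn.
  by move=> l /andP[il]; rewrite leqNgt il.
have xE w : B w -> set_val w 0 0 = r by move=> /Br.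
apply/FE; split=> [|l /andP[il lj]]; first by rewrite !xE.
pose y_ (w : T) := (set_val w : 'rV[R]_2) 0 1.
have c1 : continuous (fun q : 'rV[R]_2 => q 0 1) by exact: coord_continuous.
have sv : continuous (set_val : T -> 'rV[R]_2) by exact: initial_continuous.
have cy : continuous y_ by move=> w; exact: (continuous_comp (sv w) (c1 _)).
have : connected (y_ @` B).
  by apply: connected_continuous_connected => //; exact/continuous_subspaceT.
move/connected_intervalP => /(_ (y_ p) (y_ q)) itv.
have [w Bw yw] : (y_ @` B) (cut l).
  apply: itv; [by exists p|by exists q|apply/andP; split].
    move: oi => /andP[_ p1]; apply: (le_trans p1); apply: cut_le.
    by rewrite il leqW // (leq_trans lj).
  move: oj => /andP[q0 _]; apply: le_trans q0; apply: cut_le.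
  by rewrite lj leqW.
have ll : (0 < l <= n)%N by rewrite (leq_trans _ il) // (leq_trans lj).
by rewrite (xE _ Bp) -(xE _ Bw); apply: (cregion_cut (inT w) ll).
Qed.

End Map.

Variable V : set X.
Hypotheses (Xhausdorff : hausdorff_space X)
  (br_vertex : forall v, V v -> exists2 i, (i <= n)%N & br i (h i) = v)
  (br_ancestor : forall i j, (j <= i <= n)%N -> ancestor pa i j -> V (br i (h j))).

(** Each tree vertex is the image of a corner, and a singular point is a corner or the vertex of an
    arc [k], which is mapped to the parent of the vertex [k]. *)
Lemma region_PR_graph :
  PR_defined region 'I_n.+1 /\ graph_isomorphic V (PR_vertices region side).
Proof.
have [F FP] := reeb_map_exists.
have Tc : compact [set: T].
  by apply: compact_set_type; rewrite (closure_region P); exact: (cregion_compact P).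
have Fc := reeb_map_continuous FP.
have Fs := reeb_map_surj FP.
have Ff := reeb_map_fiber FP.
split; first by split; [exact: finite_finset|exact: (reeb_quot_proper Tc Xhausdorff Fc Fs Ff)].
have [f [g [fc gc fK gK gE]]] := reeb_factor_homeo Tc Xhausdorff Fc Fs Ff.
have fE (w : T) : f (F w) = PR_quot w by rewrite -gE gK.
exists f, g; split=> //; apply/seteqP; split=> [_ [v /br_vertex[i le_in <-] <-]|_ [p sp <-]].
  have ci : corner i (vec2 (h i) (b i)) by rewrite /corner !vec2E.
  have cp := corner_cregion P le_in ci.
  exists (mkT cp); first exact: (corner_singular P le_in ci).
  by rewrite -fE (reeb_map_corner FP (p := mkT cp) le_in ci).
exists (F p); last exact: fE.
have [_ [[i le_in ci]|[k kk [px py]]]] := singular_cases P sp.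
  rewrite (reeb_map_corner FP le_in ci); apply: br_ancestor; first by rewrite leqnn.
  exact: ancestor_refl.
rewrite (reeb_map_vertex FP kk px py); have /andP[k0 kn] := kk.
apply: br_ancestor; last exact: ancestor_parent.
by rewrite kn andbT ltnW // pa_lt.
Qed.

End Branches.
End ReebMap.

(** * Choice of the breakpoints, heights and coefficients *)

Lemma profile_exists (R : realType) (a : R) (n : nat) (pa : nat -> nat) :
  0 < a -> (0 < n)%N -> (forall i, (0 < i <= n)%N -> (pa i < i)%N) ->
  (forall i, (1 < i <= n)%N -> (0 < pa i)%N) ->
  exists a' b c t h, [/\ profile a a' n b c t h, {homo h : i j / (i < j)%N >-> i < j} &
    forall i, (1 < i <= n)%N -> t i = h (pa i)].
Proof.
move=> a0 n0 pa_lt pa_gt0; have a_neq0 : a != 0 by rewrite gt_eqF.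
(* For the arc [k + 2], [l k] and [r k] are the horizontal distances from its vertex, at the height
   of the parent, to its corners at heights [k + 1] and [k + 2]. *)
pose l k := Num.sqrt ((k.+1%:R - (pa k.+2)%:R) / a).
pose r k := Num.sqrt ((k.+2%:R - (pa k.+2)%:R) / a).
have l2 k : (k.+2 <= n)%N -> a * l k ^+ 2 = k.+1%:R - (pa k.+2)%:R.
  move=> kn; rewrite sqr_sqrtr; first by rewrite mulrC divfK.
  have := pa_lt k.+2; rewrite kn => /(_ isT) pk.
  by rewrite divr_ge0 ?(ltW a0) // subr_ge0 ler_nat.
have r2 k : (k.+2 <= n)%N -> a * r k ^+ 2 = k.+2%:R - (pa k.+2)%:R.
  move=> kn; rewrite sqr_sqrtr; first by rewrite mulrC divfK.
  have := pa_lt k.+2; rewrite kn => /(_ isT) pk.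
  by rewrite divr_ge0 ?(ltW a0) // subr_ge0 ler_nat ltnW.
have r_gt0 k : (k.+2 <= n)%N -> 0 < r k.
  move=> kn; have := pa_lt k.+2; rewrite kn => /(_ isT) pk.
  by rewrite sqrtr_gt0 divr_gt0 // subr_gt0 ltr_nat.
(* [b1 k] is the breakpoint [k + 1]; the corner [1] is put at [0] and the root corner at [-1]. *)
pose b1 := fix b1 k : R := if k is k'.+1 then b1 k' + l k' + r k' else 0.
have b1_ge0 k : 0 <= b1 k.
  by elim: k => //= k IH; rewrite !addr_ge0 ?sqrtr_ge0.
pose b i : R := if i is k.+1 then b1 k else -1.
have bn0 : 0 < b n + 1 by case: n n0 {pa_lt pa_gt0 l2 r2 r_gt0} => // m _ /=; apply: ltr_wpDl.
(* The depth of the root. The first summand makes [a'] exceed [a]; the second one gives [c1 < -1],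
   so that the first arc ascends from the root corner on. *)
pose m : R := a * (b n + 1) ^+ 2 + a + 1.
have q0 : 0 < a * (b n + 1) ^+ 2 by rewrite mulr_gt0 // exprn_gt0.
have m0 : 0 < m by rewrite /m; lra.
(* With [t 1] chosen to give height [1] at [0], this solves [arc 1 (-1) = - m]. *)
pose c1 := - (1 + (m + 1) / a) / 2.
have c1E : a * (1 + 2 * c1) = - (m + 1) by rewrite /c1; field.
have c1lt : c1 < -1.
  suff : 1 < (m + 1) / a by rewrite /c1; lra.
  by rewrite ltr_pdivlMr // mul1r /m; lra.
(* Arcs are numbered from [1]; index [0] gets default values here and in [t]. *)
pose c i : R := if i is j.+1 then if j is k.+1 then b1 k + l k else c1 else 0.
pose h i : R := if i is k.+1 then k.+1%:R else - m.
pose t i : R := if (i <= 1)%N then 1 - a * c1 ^+ 2 else (pa i)%:R.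
(* Forced by [prof_end]: the bottom has to reach the corner [n]. *)
pose a' := (h n + m) / (b n + 1) ^+ 2.
exists a', b, c, t, h; split.
- split => //.
  + rewrite /a' ltr_pdivlMr ?exprn_gt0 //.
    have hE k : (0 < k)%N -> h k = k%:R by case: k.
    have : 1 <= h n by rewrite hE // ler1n.
    by rewrite /m; lra.
  + case=> [|i] lt_in /=; first by rewrite ltrN10.
    by rewrite -addrA ltrDl ltr_wpDl ?sqrtr_ge0 ?r_gt0.
  + case=> // -[|i] /andP[_ le_in] /=; first exact: lt_trans c1lt (ltrN10 _).
    by rewrite ltrDl r_gt0.
  + by case=> // i _ /=; rewrite lerDl sqrtr_ge0.
  + case=> // -[|i] /andP[_ le_in]; rewrite /arc /=; first by rewrite sub0r sqrrN addrC subrK.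
    by rewrite /t /= [b1 i + l i + r i]addrC addrK r2 // subrK.
  + case=> [|i] lt_in; rewrite /arc /t /=.
      have -> : a * (-1 - c1) ^+ 2 + (1 - a * c1 ^+ 2) = a * (1 + 2 * c1) + 1 by ring.
      by rewrite c1E; ring.
    by rewrite opprD addNKr sqrrN l2 // subrK.
  + by rewrite /a' /= !opprK mulfVK // expf_neq0 // gt_eqF.
- move=> [|i] [|j] //= ij; last by rewrite ltr_nat.
  by apply: lt_trans (ltr0Sn _ _); rewrite oppr_lt0.
- move=> i i1; rewrite /t leqNgt; have /andP[-> _] /= := i1.
  by have := pa_gt0 _ i1; case: (pa i).
Qed.

Theorem theorem1 (R : realType) (SP : set 'rV[R]_2) (hSP : is_parabola SP)
    (X : topologicalType) (V : set X) (E : finType) (phi : E -> R -> X)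
    (hG : is_tree V phi) :
  exists SP' : set 'rV[R]_2, [/\ is_parabola SP', SP' <> SP &
    exists (D : set 'rV[R]_2) (L : finType) (S : L -> set 'rV[R]_2)
        (f : L -> mpoly 2 R),
      [/\ is_RA_region D S f,
          forall l, is_parabola (S l) /\
            (congruent (S l) SP \/ congruent (S l) SP'),
          PR_defined D L &
          graph_isomorphic V (PR_vertices D S)]].
Proof.
have [G _ _] := hG; have [a [p [a_neq0 SPc]]] := hSP.
have a0 : 0 < `|a| by rewrite normr_gt0.
have [n [pa [[n0 pa_lt pa_gt0] branches]]] := tree_branches hG.
have [a' [b [c [t [h [P h_inc t_pa]]]]]] := profile_exists a0 n0 pa_lt pa_gt0.
have [br [br_cont br_eq br_surj br_vertex br_anc]] := branches h h_inc.
have a'0 : 0 < a' := lt_trans a0 (prof_lt_a P).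
have [PRd iso] := region_PR_graph P pa_lt t_pa br_cont br_eq br_surj
  (graph_hausdorff G) br_vertex br_anc.
(* The second parabola must differ from [SP] as a set; of the two distinct translates [Q 0] and
   [Q 1], at least one does. *)
pose Q (s : R) : set 'rV[R]_2 :=
  [set x | x 0 1 = a' * (x 0 0 - vec2 0 s 0 0) ^+ 2 + vec2 0 s 0 1].
have Q_parabola s : is_parabola (Q s).
  by exists a', (vec2 0 s); split; [rewrite gt_eqF|exact: congruent_refl].
have [s Qs] : exists s, Q s <> SP.
  case: (pselect (Q 0 = SP)) => [Q0|]; last by exists 0.
  exists 1 => Q1; have : Q 0 (vec2 0 1).
    by rewrite Q0 -Q1 /Q /= !vec2E subrr expr0n mulr0 add0r.
  by rewrite /Q /= !vec2E subrr expr0n mulr0 addr0 => /eqP; rewrite oner_eq0.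
exists (Q s); split=> //.
exists (@region R `|a| a' n b c t h), 'I_n.+1, (@side R `|a| a' n b c t h),
  (@side_eqn R `|a| a' n b c t h); split=> //; first exact: (region_is_RA_region P).
move=> l; split.
  by apply: side_parabola_is_parabola; exact: (side_coef_gt0 P).
rewrite /side /side_coef; case: ifP => _; [right|left].
  by have := side_parabola_congruent a' (side_mid b c l) (side_tip t h l) (vec2 0 s);
    rewrite gtr0_norm.
apply: congruent_trans (congruent_sym SPc).
exact: side_parabola_congruent.
Qed.
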